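(* Let $c>0$ with $c^2\in[0.83,1]$, $k_0=\pi/2$, $\alpha=c^2(\pi/2)^2-2$. There exists $X>0$ such that for every $x_0\in2\mathbb{Z}$ with $x_0\ge X$ the function $$u=v_{\mathrm p}+\beta_{\mathrm e}u_{\mathrm e}+\tilde\gamma\cos(k_0\,\cdot)-\tilde r,$$ with $v_{\mathrm p},\beta_{\mathrm e},u_{\mathrm e},\tilde\gamma,\tilde r$ (depending on $x_0$) as defined in the context, is an even solution on $\mathbb{R}$ of $$c^2u''-\Delta_Du+\alpha u-\alpha\operatorname{sgn}(u)=0 ,$$ and $u$ makes exactly two transitions between the wells $\{u<0\}$ and $\{u>0\}$ of the on-site potential, located at $-x_0$ and $+x_0$: $u(\pm x_0)=0$, $u<0$ on the finite interval $(-x_0,x_0)$, and $u>0$ on $\mathbb{R}\setminus[-x_0,x_0]$.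
   Context: Functions are real-valued; $\Delta_Du(x):=u(x+1)-2u(x)+u(x-1)$; $Lu:=c^2u''-\Delta_Du+\alpha u$; $\operatorname{sgn}(0)=0$. $H^2_{\mathrm e}(\mathbb{R})$ denotes the even functions in $H^2(\mathbb{R})$. Single-transition solution (known result of Kreiner and Zimmer, taken as given): for $c^2\in[0.83,1]$ there is an odd $u_*\in H^2_{\mathrm{loc}}(\mathbb{R})$ solving $Lu_*-\alpha\operatorname{sgn}(u_* )=0$, with $\operatorname{sgn}(u_*(x))=\operatorname{sgn}(x)$, $u_*'(0)>0$, $\liminf_{|x|\to\infty}|u_*(x)|>0$, and such that $u_*$ minus the function $\operatorname{sgn}(x)\,(1-B\cos(k_0x))$, with $B=\frac{c^2k_0^2-2}{c^2k_0^2-k_0}$, tends to $0$ in $H^2(z-2,z+2)$ as $|z|\to\infty$. Definitions, for positive $x_0\in2\mathbb{Z}$: (i) $v_{\mathrm p}(x):=\left(\tfrac12+\lambda(x)\right)u_*(x-x_0)-\left(\tfrac12-\lambda(x)\right)u_*(x+x_0)$, where $\lambda\in C^\infty(\mathbb{R},\mathbb{R})$ is a fixed odd, non-decreasing function with $\lambda(x)=-1/2$ for $x\le-1$ and $\lambda(x)=1/2$ for $x\ge1$. (ii) $u_{\mathrm e}\in H^2_{\mathrm{loc}}(\mathbb{R})$ is a fixed even function with $(1+x^2)\frac{\mathrm d^l}{\mathrm dx^l}\bigl(u_{\mathrm e}(x)-\operatorname{sgn}(x)\sin(k_0x)\bigr)\in L^2(\mathbb{R}\setminus[-1,1])$ for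 $l=0,1,2$ (for example $u_{\mathrm e}$ agrees with $\operatorname{sgn}(x)\sin(k_0x)$ outside a bounded interval). (iii) $\beta_{\mathrm e}:=\frac{1}{2(c^2k_0-1)}\int_{\mathbb{R}}\left[-Lv_{\mathrm p}+\alpha\operatorname{sgn}(v_{\mathrm p})\right]\cos(k_0x)\,dx$. (iv) $\tilde r\in H^2_{\mathrm e}(\mathbb{R})$ is the solution of $L\tilde r=\beta_{\mathrm e}Lu_{\mathrm e}+Lv_{\mathrm p}-\alpha\operatorname{sgn}(v_{\mathrm p})$. (v) $\tilde\gamma:=\left\{\tilde r(x_0)-\beta_{\mathrm e}u_{\mathrm e}(x_0)\right\}\cos(k_0x_0)^{-1}$ (note $\cos(k_0x_0)=\pm1$ for $x_0\in2\mathbb{Z}$). *)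

(* Defs.v *)
From HB Require Import structures.
From mathcomp Require Import all_boot all_order all_algebra.
From mathcomp Require Import all_classical all_reals all_analysis.

Set Implicit Arguments.
Unset Strict Implicit.
Unset Printing Implicit Defensive.

Import Order.TTheory GRing.Theory Num.Theory.
Import numFieldNormedType.Exports.

Local Open Scope ring_scope.
Local Open Scope classical_set_scope.

Definition even_fun (R : realType) (f : R -> R) : Prop :=
  forall x, f (- x) = f x.

Definition odd_fun (R : realType) (f : R -> R) : Prop :=
  forall x, f (- x) = - f x.

Definition smooth (R : realType) (f : R -> R) : Prop :=
  forall (n : nat) (x : R), derivable (derive1n n f) x 1.

Definition L2 (R : realType) (D : set R) (f : R -> R) : Prop :=
  measurable_fun D f /\
  (\int[@lebesgue_measure R]_(x in D) ((f x) ^+ 2)%:E < +oo)%E.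

Definition L2loc (R : realType) (f : R -> R) : Prop :=
  forall K : set R, compact K -> L2 K f.

(* Weak derivatives are defined by testing against C^1_c(D), as in Brezis'
   textbook; C^oo_c(D) yields the same notion. *)
Definition test_function (R : realType) (D : set R) (phi : R -> R) : Prop :=
  [/\ forall x, derivable phi x 1,
      continuous (derive1 phi) &
      exists K : set R,
        [/\ compact K, K `<=` D & forall x, ~ K x -> phi x = 0]].

Definition is_weak_derivative (R : realType) (D : set R) (u g : R -> R) : Prop :=
  [/\ locally_integrable D u, locally_integrable D g &
      forall phi, test_function D phi ->
        \int[@lebesgue_measure R]_(x in D) (u x * derive1 phi x) =
        - \int[@lebesgue_measure R]_(x in D) (g x * phi x)].

Definition weakly_derivable (R : realType) (D : set R) (u : R -> R) : Prop :=
  exists g, is_weak_derivative D u g.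

(* A chosen weak derivative of u on the open set D. It is unique only up to a
   null set, so it is used below only in integrals and in a.e. statements. *)
Definition wderiv (R : realType) (D : set R) (u : R -> R) : R -> R :=
  xget (fun=> 0) [set g | is_weak_derivative D u g].

Definition wderivn (R : realType) (D : set R) (n : nat) (u : R -> R) : R -> R :=
  iter n (wderiv D) u.

(* Elements of H^2(R) and H^2_loc(R) are identified with their continuous
   representative, which is then automatically of class C^1. *)
Definition H2 (R : realType) (u : R -> R) : Prop :=
  [/\ continuous u,
      forall l : nat, (l < 2)%N -> weakly_derivable [set: R] (wderivn [set: R] l u) &
      forall l : nat, (l <= 2)%N -> L2 [set: R] (wderivn [set: R] l u)].

Definition H2loc (R : realType) (u : R -> R) : Prop :=
  [/\ continuous u,
      forall l : nat, (l < 2)%N -> weakly_derivable [set: R] (wderivn [set: R] l u) &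
      forall l : nat, (l <= 2)%N -> L2loc (wderivn [set: R] l u)].

Definition H2norm (R : realType) (D : set R) (u : R -> R) : \bar R :=
  sqrte (\int[@lebesgue_measure R]_(x in D)
           (\sum_(l < 3) (wderivn D l u x) ^+ 2)%:E)%E.

Definition k0 (R : realType) : R := pi / 2.

Definition alpha (R : realType) (c : R) : R := c ^+ 2 * (pi / 2) ^+ 2 - 2.

Definition discrete_laplacian (R : realType) (u : R -> R) (x : R) : R :=
  u (x + 1) - 2 * u x + u (x - 1).

Definition L (R : realType) (c : R) (u : R -> R) (x : R) : R :=
  c ^+ 2 * wderivn [set: R] 2 u x - discrete_laplacian u x + alpha c * u x.

Definition is_solution (R : realType) (c : R) (u : R -> R) : Prop :=
  H2loc u /\
  {ae @lebesgue_measure R, forall x, L c u x - alpha c * Num.sg (u x) = 0}.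

Definition asymptotic_amplitude (R : realType) (c : R) : R :=
  (c ^+ 2 * k0 R ^+ 2 - 2) / (c ^+ 2 * k0 R ^+ 2 - k0 R).

Definition asymptotic_profile (R : realType) (c x : R) : R :=
  Num.sg x * (1 - asymptotic_amplitude c * cos (k0 R * x)).

Definition H2_window_error (R : realType) (c : R) (u : R -> R) (z : R) : \bar R :=
  H2norm `]z - 2, z + 2[ (fun x => u x - asymptotic_profile c x).

Definition single_transition (R : realType) (c : R) (us : R -> R) : Prop :=
  [/\ odd_fun us, is_solution c us & forall x, Num.sg (us x) = Num.sg x] /\
  [/\ 0 < derive1 us 0,
      (0 < limf_einf (fun x => `|us x|%:E) (pinfty_nbhs R))%E /\
      (0 < limf_einf (fun x => `|us x|%:E) (ninfty_nbhs R))%E &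
      H2_window_error c us z @[z --> +oo] --> 0%E /\
      H2_window_error c us z @[z --> -oo] --> 0%E].

Definition transition_function (R : realType) (lambda : R -> R) : Prop :=
  [/\ smooth lambda,
      odd_fun lambda,
      {homo lambda : x y / x <= y},
      forall x, x <= -1 -> lambda x = - (1 / 2) &
      forall x, 1 <= x -> lambda x = 1 / 2].

Definition vp (R : realType) (lambda us : R -> R) (x0 x : R) : R :=
  (1 / 2 + lambda x) * us (x - x0) - (1 / 2 - lambda x) * us (x + x0).

Definition even_profile (R : realType) (ue : R -> R) : Prop :=
  [/\ H2loc ue, even_fun ue &
      forall l : nat, (l <= 2)%N ->
        L2 (~` `[-1, 1]) (fun x => (1 + x ^+ 2) *
          wderivn (~` `[-1, 1]) l
            (fun y => ue y - Num.sg y * sin (k0 R * y)) x)].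

Definition beta_e (R : realType) (c : R) (lambda us : R -> R) (x0 : R) : R :=
  (2 * (c ^+ 2 * k0 R - 1))^-1 *
  \int[@lebesgue_measure R]_x
    ((- L c (vp lambda us x0) x + alpha c * Num.sg (vp lambda us x0 x))
     * cos (k0 R * x)).

Definition is_correction (R : realType) (c : R) (lambda us ue : R -> R) (x0 : R)
    (r : R -> R) : Prop :=
  [/\ H2 r, even_fun r &
      {ae @lebesgue_measure R, forall x,
         L c r x = beta_e c lambda us x0 * L c ue x
                   + L c (vp lambda us x0) x
                   - alpha c * Num.sg (vp lambda us x0 x)}].

Definition gamma_tilde (R : realType) (c : R) (lambda us ue r : R -> R) (x0 : R) : R :=
  (r x0 - beta_e c lambda us x0 * ue x0) * (cos (k0 R * x0))^-1.

Definition two_transition_ansatz (R : realType) (c : R) (lambda us ue r : R -> R)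
    (x0 x : R) : R :=
  vp lambda us x0 x + beta_e c lambda us x0 * ue x
  + gamma_tilde c lambda us ue r x0 * cos (k0 R * x) - r x.

(* Main.v *)
Require Import Defs.
From HB Require Import structures.
From mathcomp Require Import all_boot all_order all_algebra.
From mathcomp Require Import all_classical all_reals all_analysis.
From mathcomp Require Import measurable_realfun ring lra.

(** Since [cos (k0 x)] is annihilated by [L] and the correction [r] absorbs the
    residual of the glued wave [vp], the ansatz [u] satisfies [L u = alpha sgn vp]
    almost everywhere. It is a solution as soon as [u] and [vp] have the same
    signs. The coefficient gamma makes the perturbation [w = u - vp] vanish at
    [x0], so it suffices that [w] be small in [C^1]: near [x0] the derivative of
    [vp] is positive, elsewhere [vp] is bounded away from zero
    ([glued_wave_sign]).

    The residual of [vp] is explicit ([vp_defect]): both translates solve the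
    equation, hence only commutators with the cut-off remain. They live in
    [-2, 2] and involve the sum of the translates [us (x - x0)] and
    [us (x + x0)], whose periodic tails cancel because [x0] is an even integer
    ([translates_cancel]). So the residual, and with it beta, tends to zero. The
    source of the equation for [r] is the residual plus a multiple of the image
    of the even profile, which is integrable ([even_profile_bounds]).

    The main point is a bound for [r] by the [L^1] norm of its source
    ([apriori_bound]), although [L] has the resonant frequencies [k0] and [-k0].
    As [k0 = pi/2], [L r = c^2 (r'' + k0^2 r) - r (x + 1) - r (x - 1)]. Testing
    against [sin (k0 (y - x))] on a half-line and using
    [cos (t + pi/2) = - sin t], the shifts of [r] telescope, and what remains is
    that [c^2 k0 r x] differs from the integral of [r y cos (k0 (y - x))] over
    [x - 1, x + 1] by at most the norm of the source. The cosine has integral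
    [2 / k0] there, and [c^2 k0 > 2 / k0] follows from [c^2 >= 0.83] and a lower
    bound for pi, so the supremum of [r] is bounded. A shifted phase gives the
    same for the derivative of [r]. This replaces the Fourier transform by a
    contraction in the supremum norm.

    All of this happens with weak derivatives. [H2loc_rep] and [H2rep_wderivn]
    translate between these and pairs of a [C^1] function and the density of its
    absolutely continuous derivative ([H2rep]), for which the product rule
    [abs_contM] and a Sobolev inequality [sobolev_sup] are available. *)

Set Implicit Arguments.
Unset Strict Implicit.
Unset Printing Implicit Defensive.

Import Order.TTheory GRing.Theory Num.Theory.
Import numFieldNormedType.Exports.

Local Open Scope ring_scope.
Local Open Scope classical_set_scope.

(** * Differentiation and integration on the line *)

Section segment_integral.
Variable R : realType.
Implicit Types (f g u p : R -> R) (a b x : R).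
Local Notation mu := (@lebesgue_measure R).
Local Notation loc_int := (locally_integrable [set: R]).

Lemma is_deriveDf f g x a b : is_derive x 1 f a -> is_derive x 1 g b ->
  is_derive x 1 (fun y => f y + g y) (a + b).
Proof. by move=> hf hg; exact: is_deriveD. Qed.

Lemma is_deriveBf f g x a b : is_derive x 1 f a -> is_derive x 1 g b ->
  is_derive x 1 (fun y => f y - g y) (a - b).
Proof. by move=> hf hg; exact: is_deriveB. Qed.

Lemma is_deriveMf f g x a b : is_derive x 1 f a -> is_derive x 1 g b ->
  is_derive x 1 (fun y => f y * g y) (a * g x + f x * b).
Proof.
move=> hf hg; apply: (@is_derive_eq _ _ _ _ _ _ _ _ (is_deriveM hf hg)).
by rewrite /GRing.scale /= addrC mulrC.
Qed.

Lemma is_deriveZf k f x a : is_derive x 1 f a ->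
  is_derive x 1 (fun y => k * f y) (k * a).
Proof. by move=> hf; exact: is_deriveZ. Qed.

Lemma is_derive_affine k a x : is_derive x 1 (fun y => k * (y + a)) k.
Proof.
have h : is_derive x 1 (fun y : R => y + a) (1 + 0).
  exact: is_deriveDf.
by have := is_deriveZf k h; rewrite addr0 mulr1.
Qed.

Lemma is_derive_comp_affine f k a x d : is_derive (k * (x + a)) 1 f d ->
  is_derive x 1 (fun y => f (k * (y + a))) (k * d).
Proof.
move=> h; rewrite mulrC.
exact: (@is_derive1_comp R f (fun y => k * (y + a)) x _ _ h (is_derive_affine _ _ _)).
Qed.

Lemma is_derive_shift f a x d : is_derive (x + a) 1 f d ->
  is_derive x 1 (fun y => f (y + a)) d.
Proof.
move=> h.
have := @is_derive_comp_affine f 1 a x d; rewrite !mul1r => /(_ h).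
by under eq_fun do rewrite mul1r.
Qed.

Lemma is_derive_continuous f p : (forall x, is_derive x 1 f (p x)) -> continuous f.
Proof.
move=> h x; apply: differentiable_continuous; apply/derivable1_diffP.
by case: (h x).
Qed.

Lemma continuousDf f g : continuous f -> continuous g ->
  continuous (fun x => f x + g x).
Proof. by move=> cf cg x; apply: cvgD; [exact: cf|exact: cg]. Qed.

Lemma continuousBf f g : continuous f -> continuous g ->
  continuous (fun x => f x - g x).
Proof. by move=> cf cg x; apply: cvgB; [exact: cf|exact: cg]. Qed.

Lemma continuousMf f g : continuous f -> continuous g ->
  continuous (fun x => f x * g x).
Proof. by move=> cf cg x; apply: cvgM; [exact: cf|exact: cg]. Qed.

Lemma continuous_translate f a : continuous f -> continuous (fun x => f (x + a)).
Proof.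
move=> cf x; apply: (@continuous_comp _ _ _ (fun y => y + a) f); last exact: cf.
by apply: cvgD; [exact: cvg_id|exact: cvg_cst].
Qed.

Lemma near_dist x e : 0 < e -> \forall y \near x, `|y - x| < e.
Proof.
by move=> e0; apply/nbhs_ballP; exists e => //= y; rewrite /ball /= distrC.
Qed.

Lemma is_derive0_squeeze f (w : R -> R) x :
  {for x, continuous w} -> w x = 0 ->
  (\forall y \near x, `|f y - f x| <= `|y - x| * `|w y|) -> is_derive x 1 f 0.
Proof.
move=> cw wx H; apply/is_derive1_caratheodory.
pose g y := if y == x then 0 else (f y - f x) / (y - x).
have gx : g x = 0 by rewrite /g eqxx.
exists g; split => //.
  move=> z; rewrite /g; case: eqVneq => [->|zx]; first by rewrite !subrr mulr0.
  by rewrite divfK// subr_eq0.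
rewrite /prop_for /continuous_at gx; apply/cvgr0Pnorm_le => e e0.
have : w y @[y --> x] --> 0 by rewrite -wx.
  move=> /cvgr0Pnorm_le /(_ e e0) W.
  near=> y; rewrite /g; case: eqVneq => [_|yx]; first by rewrite normr0 ltW.
  have wy : `|w y| <= e by near: y; exact: W.
  rewrite normf_div ler_pdivrMr ?normr_gt0 ?subr_eq0//.
  apply: (@le_trans _ _ (`|y - x| * `|w y|)); first by near: y; exact: H.
  by rewrite mulrC ler_wpM2r.
Unshelve. all: by end_near. Qed.

Lemma ae_imply (P Q : R -> Prop) : (forall x, P x -> Q x) ->
  {ae mu, forall x, P x} -> {ae mu, forall x, Q x}.
Proof. by move=> PQ; apply: filterS; [exact: (ae_filter_ringOfSetsType mu)|exact: PQ]. Qed.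

Lemma ae_imply2 (P1 P2 Q : R -> Prop) : (forall x, P1 x -> P2 x -> Q x) ->
  {ae mu, forall x, P1 x} -> {ae mu, forall x, P2 x} -> {ae mu, forall x, Q x}.
Proof. by move=> PQ; apply: filterS2; [exact: (ae_filter_ringOfSetsType mu)|exact: PQ]. Qed.

Lemma ae_imply3 (P1 P2 P3 Q : R -> Prop) : (forall x, P1 x -> P2 x -> P3 x -> Q x) ->
  {ae mu, forall x, P1 x} -> {ae mu, forall x, P2 x} -> {ae mu, forall x, P3 x} ->
  {ae mu, forall x, Q x}.
Proof. by move=> PQ; apply: filterS3; [exact: (ae_filter_ringOfSetsType mu)|exact: PQ]. Qed.

Lemma loc_int_segment f a b : loc_int f -> mu.-integrable `[a, b] (EFin \o f).
Proof.
move=> [mf _ H]; apply/integrableP; split.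
  by apply/measurable_EFinP; exact: measurable_funTS.
by apply: H => //; exact: segment_compact.
Qed.

Lemma loc_int_sub f D : open D -> loc_int f -> locally_integrable D f.
Proof.
move=> oD [mf _ H]; split => //; first exact: measurable_funTS.
by move=> K _; exact: H.
Qed.

Lemma compact_sub_segment (K : set R) : compact K ->
  exists2 M : R, 0 < M & K `<=` `[- M, M].
Proof.
move=> /compact_bounded [M [Mr H]].
exists (`|M| + 1); first by rewrite ltr_wpDl.
move=> x Kx /=; rewrite in_itv /= -ler_norml.
by apply: H => //; rewrite (le_lt_trans (ler_norm M)) // ltrDl.
Qed.

Lemma continuous_loc_int f : continuous f -> loc_int f.
Proof.
move=> cf; split => //; first exact: continuous_measurable_fun.
  exact: openT.
move=> K _ cK.
have : mu.-integrable K (EFin \o f).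
  by apply: continuous_compact_integrable => //; exact: continuous_subspaceT.
by case/integrableP.
Qed.

Lemma continuous_segment_bounded f a b : continuous f ->
  exists2 M, 0 < M & forall x, a <= x <= b -> `|f x| <= M.
Proof.
move=> cf.
have : compact [set f x | x in `[a, b]].
  by apply: continuous_compact; [exact: continuous_subspaceT|exact: segment_compact].
move=> /compact_sub_segment[M M0 H]; exists M => // x xab.
rewrite ler_norml; have := H (f x); rewrite /= in_itv /=; apply.
by exists x => //=; rewrite in_itv.
Qed.

Lemma loc_intM f g : continuous f -> loc_int g -> loc_int (fun x => f x * g x).
Proof.
move=> cf [mg oT H]; split => //.
  by apply: measurable_funM => //; exact: continuous_measurable_fun.
move=> K KT cK; have mK := compact_measurable cK.
have : mu.-integrable K ((EFin \o f) \* (EFin \o g))%E.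
  apply: integrableMr => //.
  - by apply: measurable_funTS; exact: continuous_measurable_fun.
  - have [M M0 KM] := compact_sub_segment cK.
    have [N N0 HN] := @continuous_segment_bounded f (- M) M cf.
    exists N; split; first exact: num_real.
    move=> x Nx y Ky; apply: (le_trans _ (ltW Nx)); apply: HN.
    by have := KM _ Ky; rewrite /= in_itv.
  - apply/integrableP; split; last exact: H.
    by apply/measurable_EFinP; exact: measurable_funTS.
by case/integrableP.
Qed.

Lemma loc_intZ k f : loc_int f -> loc_int (fun x => k * f x).
Proof. by move=> lf; apply: loc_intM => //; exact: cst_continuous. Qed.

Lemma loc_int_norm f : loc_int f -> loc_int (fun x => `|f x|).
Proof.
move=> [mf oT H]; split => //; first exact: measurableT_comp.
by move=> K KT cK; under eq_integral do rewrite normr_id; exact: H.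
Qed.

Lemma int_chasles f a b x : loc_int f -> a <= x -> x <= b ->
  \int[mu]_(t in `[a, b]) f t =
  \int[mu]_(t in `[a, x]) f t + \int[mu]_(t in `[x, b]) f t.
Proof.
move=> lf ax xb.
rewrite -(@Rintegral_itv_obnd_cbnd _ x (BRight b)); last first.
  apply: (@integrableS _ _ _ mu `[x, b]) => //; last exact: loc_int_segment.
  by apply: subset_itvr; rewrite bnd_simp.
rewrite -(@Rintegral_itvB _ f (BLeft a) (BRight b) x) ?bnd_simp//.
  by rewrite addrC subrK.
exact: loc_int_segment.
Qed.

Lemma le_int_segment f g a b : loc_int f -> loc_int g ->
  (forall x, a <= x <= b -> f x <= g x) ->
  \int[mu]_(t in `[a, b]) f t <= \int[mu]_(t in `[a, b]) g t.
Proof.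
by move=> lf lg H; apply: le_Rintegral => //; exact: loc_int_segment.
Qed.

Lemma int_segment_ge0 f a b : (forall x, a <= x <= b -> 0 <= f x) ->
  0 <= \int[mu]_(t in `[a, b]) f t.
Proof. by move=> H; apply: Rintegral_ge0 => x /=; rewrite in_itv; exact: H. Qed.

Lemma le_norm_int f a b : loc_int f ->
  `|\int[mu]_(t in `[a, b]) f t| <= \int[mu]_(t in `[a, b]) `|f t|.
Proof. by move=> lf; apply: le_normr_Rintegral => //; exact: loc_int_segment. Qed.

Lemma int_segment_cst k a b : a <= b -> \int[mu]_(t in `[a, b]) k = k * (b - a).
Proof.
move=> ab; rewrite Rintegral_cst//= lebesgue_measure_itv /= lte_fin.
case: ltP => [|ba] //=.
by have -> : a = b; [apply/eqP; rewrite eq_le ab ba|rewrite subrr].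
Qed.

Lemma int_segment_le f a b M : a <= b -> loc_int f ->
  (forall x, a <= x <= b -> f x <= M) ->
  \int[mu]_(t in `[a, b]) f t <= M * (b - a).
Proof.
move=> ab lf H; rewrite -int_segment_cst//; apply: le_int_segment => //.
by apply: continuous_loc_int; exact: cst_continuous.
Qed.

Lemma norm_int_segment_le f a b M : a <= b -> loc_int f ->
  (forall x, a <= x <= b -> `|f x| <= M) ->
  `|\int[mu]_(t in `[a, b]) f t| <= M * (b - a).
Proof.
move=> ab lf H; apply: (le_trans (le_norm_int _ _ lf)).
by apply: int_segment_le => //; exact: loc_int_norm.
Qed.

Lemma int_segmentD f g a b : loc_int f -> loc_int g ->
  \int[mu]_(t in `[a, b]) (f t + g t) =
  \int[mu]_(t in `[a, b]) f t + \int[mu]_(t in `[a, b]) g t.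
Proof. by move=> lf lg; apply: RintegralD => //; exact: loc_int_segment. Qed.

Lemma int_segmentB f g a b : loc_int f -> loc_int g ->
  \int[mu]_(t in `[a, b]) (f t - g t) =
  \int[mu]_(t in `[a, b]) f t - \int[mu]_(t in `[a, b]) g t.
Proof. by move=> lf lg; apply: RintegralB => //; exact: loc_int_segment. Qed.

Lemma int_segmentZ k f a b : loc_int f ->
  \int[mu]_(t in `[a, b]) (k * f t) = k * \int[mu]_(t in `[a, b]) f t.
Proof. by move=> lf; apply: RintegralZl => //; exact: loc_int_segment. Qed.

End segment_integral.

(** * Translations *)

Section translation.
Variable R : realType.
Implicit Types (f : R -> R) (h : R).
Local Notation mu := (@lebesgue_measure R).
Local Notation loc_int := (locally_integrable [set: R]).

Let translate h : measurableTypeR R -> measurableTypeR R := fun x => (x : R) + h.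

Let measurable_translate h : measurable_fun [set: measurableTypeR R] (translate h).
Proof.
apply: continuous_measurable_fun => x.
by apply: cvgD; [exact: cvg_id|exact: cvg_cst].
Qed.

Let preimage_translate h a b : translate h @^-1` `[a, b] = `[a - h, b - h]%classic.
Proof.
by apply/seteqP; split => x /=; rewrite !in_itv /= /translate lerBlDr lerBrDr.
Qed.

Lemma lebesgue_measure_translate h (A : set R) : measurable A ->
  pushforward mu (translate h) A = mu A.
Proof.
move=> mA; apply/esym/lebesgue_measure_unique => //= _ [[a b]] _ <-.
rewrite /pushforward /=.
have -> : translate h @^-1` `]a, b] = `]a - h, b - h]%classic.
  by apply/seteqP; split => x /=; rewrite !in_itv /= /translate ltrBlDr lerBrDr.
rewrite !lebesgue_measure_itv /= !lte_fin ltrD2r.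
by rewrite -!EFinB opprB addrA subrK.
Qed.

Lemma ae_translate (P : R -> Prop) h :
  {ae mu, forall x, P x} -> {ae mu, forall x, P (x + h)}.
Proof.
move=> [N [mN N0 HN]]; exists (translate h @^-1` N); split.
- by rewrite -[X in measurable X]setTI; exact: measurable_translate.
- by have := lebesgue_measure_translate h mN; rewrite /pushforward N0.
- by move=> x /= Px; exact: (HN (x + h)).
Qed.

Lemma loc_int_translate f h : loc_int f -> loc_int (fun x => f (x + h)).
Proof.
move=> [mf oT H].
have mfh : measurable_fun [set: R] (fun x => f (x + h)).
  exact: (measurableT_comp mf (measurable_translate h)).
split; [exact: mfh|exact: oT|move=> K _ cK].
have [M M0 KM] := compact_sub_segment cK.
pose y := integral mu `[- M, M] (fun x => `|f (x + h)|%:E).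
apply: (@le_lt_trans _ _ y).
  apply: ge0_subset_integral => //; first exact: compact_measurable.
  by apply/measurable_EFinP/measurableT_comp => //; exact: measurable_funTS.
rewrite /y; have -> : `[- M, M]%classic = translate h @^-1` `[- M + h, M + h].
  by rewrite preimage_translate !addrK.
have E := @ge0_integral_pushforward _ _ _ _ _ _ (measurable_translate h) mu
  `[- M + h, M + h] (fun x => `|f x|%:E).
rewrite /comp in E; rewrite -E//.
- rewrite (@eq_measure_integral _ _ _ _ mu) => //; last first.
    by move=> A mA _; exact: lebesgue_measure_translate.
  by apply: H => //; exact: segment_compact.
- by apply/measurable_EFinP/measurableT_comp => //; exact: measurable_funTS.
Qed.

Lemma int_translate f h a b : loc_int f ->
  \int[mu]_(x in `[a, b]) f (x + h) = \int[mu]_(x in `[a + h, b + h]) f x.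
Proof.
move=> lf; have [mf _ _] := lf.
have -> : `[a, b]%classic = translate h @^-1` `[a + h, b + h].
  by rewrite preimage_translate !addrK.
have E := @integral_pushforward _ _ _ _ _ _ (measurable_translate h) mu
  `[a + h, b + h] (EFin \o f).
rewrite /Rintegral; rewrite /comp in E; rewrite -E//.
- congr fine; apply: eq_measure_integral => A mA _.
  exact: lebesgue_measure_translate.
- exact/measurable_EFinP.
- rewrite preimage_translate !addrK.
  exact: (loc_int_segment _ _ (loc_int_translate h lf)).
Qed.

End translation.

(** * Absolutely continuous functions *)

(** Local absolute continuity of [u]. The density [p] is carried along because
    the function [u] determines it only up to a null set. *)
Definition abs_cont (R : realType) (u p : R -> R) : Prop :=
  locally_integrable [set: R] p /\
  forall a b, a <= b ->
    \int[@lebesgue_measure R]_(x in `[a, b]) p x = u b - u a.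

Section abs_cont.
Variable R : realType.
Implicit Types (f g u v p q : R -> R) (a b x h k : R).
Local Notation mu := (@lebesgue_measure R).
Local Notation loc_int := (locally_integrable [set: R]).

Lemma abs_cont_exists p : loc_int p -> exists u, abs_cont u p.
Proof.
move=> lp.
exists (fun x => if 0 <= x then \int[mu]_(t in `[0, x]) p t
                 else - \int[mu]_(t in `[x, 0]) p t).
split => // a b ab.
case: (leP 0 a) => a0.
  by rewrite (le_trans a0 ab) (int_chasles lp a0 ab) addrAC subrr add0r.
case: (leP 0 b) => b0; rewrite opprK.
  by rewrite (int_chasles lp (ltW a0) b0) addrC.
by rewrite (int_chasles lp ab (ltW b0)) addrC addrK.
Qed.

Lemma abs_cont_continuous u p : abs_cont u p -> continuous u.
Proof.
move=> [lp Hu] x.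
have x1 : x - 1 < x + 1 by lra.
have /(continuous_within_itvP _ x1)[cH _ _] :=
  parameterized_integral_continuous (ltW x1) (loc_int_segment _ _ lp).
have {}cH : {for x, continuous (fun y => \int[mu]_(t in `[x - 1, y]) p t)}.
  by apply: cH; rewrite in_itv /=; lra.
rewrite /continuous_at; have -> : u x = u (x - 1) + \int[mu]_(t in `[x - 1, x]) p t.
  by rewrite Hu; [rewrite addrC subrK|lra].
(* Near [x] the function is a parameterized integral, up to a constant. *)
have c2 : u (x - 1) + \int[mu]_(t in `[x - 1, y]) p t @[y --> x] -->
          u (x - 1) + \int[mu]_(t in `[x - 1, x]) p t.
  by apply: cvgD; [exact: cvg_cst|exact: cH].
apply: cvg_trans c2; apply: near_eq_cvg; near=> y.
rewrite Hu; first by rewrite addrC subrK.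
have : `|y - x| < 1 by near: y; exact: near_dist.
by rewrite ltr_norml; lra.
Unshelve. all: by end_near. Qed.

Lemma C1_abs_cont u p :
  (forall x, is_derive x 1 u (p x)) -> continuous p -> abs_cont u p.
Proof.
move=> du cp; split; first exact: continuous_loc_int.
move=> a b; rewrite le_eqVlt => /predU1P[<-|ab].
  by rewrite set_itv1 Rintegral_set1 subrr.
have cu := is_derive_continuous du.
rewrite /Rintegral (@continuous_FTC2 _ p u a b) //=.
- exact: continuous_subspaceT.
- split.
  + by move=> x _; case: (du x).
  + by apply: cvg_at_right_filter; exact: cu.
  + by apply: cvg_at_left_filter; exact: cu.
- by move=> x _; rewrite derive1E; exact: derive_val.
Qed.

Lemma abs_cont_is_derive u p : abs_cont u p -> continuous p ->
  forall x, is_derive x 1 u (p x).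
Proof.
move=> [lp Hu] cp x.
have [||||D1 D2] := @continuous_FTC1_closed R p (x - 1) x (x + 1).
- by lra.
- exact: loc_int_segment.
- by lra.
- exact: cp.
have dF : is_derive x 1 (fun y => \int[mu]_(t in `[x - 1, y]) p t + u (x - 1)) (p x).
  rewrite -[p x]addr0; apply: is_deriveDf.
  by split; [exact: D1|rewrite -derive1E; exact: D2].
have E : \forall y \near x,
   (fun y => \int[mu]_(t in `[x - 1, y]) p t + u (x - 1)) y = u y.
  near=> y; rewrite Hu ?subrK//.
  have : `|y - x| < 1 by near: y; exact: near_dist.
  by rewrite ltr_norml; lra.
exact: (near_eq_is_derive E dF).
Unshelve. all: by end_near. Qed.
End abs_cont.

Section abs_cont_algebra.
Variable R : realType.
Implicit Types (f g u v p q : R -> R) (a b x h k : R).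
Local Notation mu := (@lebesgue_measure R).
Local Notation loc_int := (locally_integrable [set: R]).

Lemma abs_contD u p v q : abs_cont u p -> abs_cont v q ->
  abs_cont (fun x => u x + v x) (fun x => p x + q x).
Proof.
move=> [lp Hp] [lq Hq]; split; first exact: locally_integrableD.
by move=> a b ab; rewrite int_segmentD// Hp// Hq//; ring.
Qed.

Lemma abs_contZ k u p : abs_cont u p ->
  abs_cont (fun x => k * u x) (fun x => k * p x).
Proof.
move=> [lp Hp]; split; first exact: loc_intZ.
by move=> a b ab; rewrite int_segmentZ// Hp// mulrBr.
Qed.

Lemma abs_contB u p v q : abs_cont u p -> abs_cont v q ->
  abs_cont (fun x => u x - v x) (fun x => p x - q x).
Proof.
move=> [lp Hp] [lq Hq]; split; first exact: locally_integrableB.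
by move=> a b ab; rewrite int_segmentB// Hp// Hq//; ring.
Qed.

Lemma abs_cont_translate h u p : abs_cont u p ->
  abs_cont (fun x => u (x + h)) (fun x => p (x + h)).
Proof.
move=> [lp Hp]; split; first exact: loc_int_translate.
by move=> a b ab; rewrite int_translate// Hp// lerD2r.
Qed.

Lemma abs_cont_variation u p : abs_cont u p -> exists2 N : R -> R,
  continuous N & forall x y, x <= y ->
    \int[mu]_(t in `[x, y]) `|p t| = N y - N x /\ `|u y - u x| <= N y - N x.
Proof.
move=> [lp Hp].
have [N HN] := abs_cont_exists (loc_int_norm lp).
exists N; first exact: abs_cont_continuous HN.
move=> x y xy; split; first exact: HN.2.
by rewrite -HN.2// -Hp//; exact: le_norm_int.
Qed.

(** The error of the product formula on a segment is quadratically small, so a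
    primitive of the expected density differs from the product by a function
    with zero derivative. *)
Lemma abs_contM f f' u p : (forall x, is_derive x 1 f (f' x)) -> continuous f' ->
  abs_cont u p ->
  abs_cont (fun x => f x * u x) (fun x => f' x * u x + f x * p x).
Proof.
move=> df cf' Hu; have [lp Hp] := Hu.
have cf := is_derive_continuous df.
have cu := abs_cont_continuous Hu.
have Hf := C1_abs_cont df cf'.
have l1 : loc_int (fun x => f' x * u x).
  by apply: loc_intM => //; exact: continuous_loc_int.
have l2 : loc_int (fun x => f x * p x) by exact: loc_intM.
have lh := locally_integrableD l1 l2.
have [P HP] := abs_cont_exists lh.
have [N cN HN] := abs_cont_variation Hu.
pose F x := f x * u x - P x.
have key x0 : exists2 M, 0 < M & forall x y, x0 - 1 <= x -> x <= y -> y <= x0 + 1 ->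
    `|F y - F x| <= (y - x) * `|M * (N y - N x)|.
  have [M M0 HM] := continuous_segment_bounded (x0 - 1) (x0 + 1) cf'.
  exists (2 * M); first by rewrite mulr_gt0.
  move=> x y xx0 xy yx0.
  have -> : F y - F x = \int[mu]_(t in `[x, y])
      (f' t * u x + f y * p t - (f' t * u t + f t * p t)).
    rewrite int_segmentB//; last first.
      apply: locally_integrableD; last exact: loc_intZ.
      under eq_fun do rewrite mulrC.
      by apply: loc_intZ; exact: continuous_loc_int.
    rewrite HP.2// int_segmentD; last 2 first.
    - under eq_fun do rewrite mulrC.
      by apply: loc_intZ; exact: continuous_loc_int.
    - exact: loc_intZ.
    under eq_Rintegral do rewrite mulrC.
    rewrite !int_segmentZ//; last exact: continuous_loc_int.
    by rewrite Hp// Hf.2// /F; ring.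
  have [N1 N2] := HN _ _ xy.
  have N0 : 0 <= N y - N x by exact: le_trans N2.
  have fM t : x <= t <= y -> `|f y - f t| <= M * (y - x).
    move=> /andP[xt ty].
    rewrite -Hf.2//; apply: (@le_trans _ _ (M * (y - t))).
      apply: norm_int_segment_le => //; first exact: Hf.1.
      by move=> s /andP[ts sy]; apply: HM; lra.
    by apply: ler_wpM2l; [exact: ltW|lra].
  rewrite (@ger0_norm _ (2 * M * _)); last by rewrite mulr_ge0// mulr_ge0// ltW.
  apply: (@le_trans _ _ (\int[mu]_(t in `[x, y])
     (M * (N y - N x) + M * (y - x) * `|p t|))).
    apply: (le_trans (le_norm_int _ _ _)).
      apply: locally_integrableB => //.
      apply: locally_integrableD; last exact: loc_intZ.
      under eq_fun do rewrite mulrC.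
      by apply: loc_intZ; exact: continuous_loc_int.
    apply: le_int_segment.
    - apply: loc_int_norm; apply: locally_integrableB => //.
      apply: locally_integrableD; last exact: loc_intZ.
      under eq_fun do rewrite mulrC.
      by apply: loc_intZ; exact: continuous_loc_int.
    - apply: locally_integrableD; last by apply: loc_intZ; exact: loc_int_norm.
      by apply: continuous_loc_int; exact: cst_continuous.
    - move=> t /andP[xt ty].
      have -> : f' t * u x + f y * p t - (f' t * u t + f t * p t) =
        f' t * (u x - u t) + (f y - f t) * p t by ring.
      apply: (le_trans (ler_normD _ _)); rewrite !normrM; apply: lerD.
        apply: ler_pM => //; first by apply: HM; lra.
        rewrite distrC; apply: (le_trans (HN _ _ xt).2).
        by rewrite lerD2r -subr_ge0; apply: le_trans (HN _ _ ty).2.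
      by apply: ler_wpM2r => //; apply: fM; rewrite xt.
  rewrite int_segmentD; last 2 first.
  - by apply: continuous_loc_int; exact: cst_continuous.
  - by apply: loc_intZ; exact: loc_int_norm.
  rewrite int_segment_cst// int_segmentZ; last exact: loc_int_norm.
  by rewrite N1 le_eqVlt; apply/orP; left; apply/eqP; ring.
have dF x : is_derive x 1 F 0.
  have [M M0 H] := key x.
  apply: (@is_derive0_squeeze _ _ (fun y => M * (N y - N x))).
  - apply: cvgM; first exact: cvg_cst.
    by apply: cvgB; [exact: cN|exact: cvg_cst].
  - by rewrite subrr mulr0.
  - near=> y.
    have : `|y - x| < 1 by near: y; exact: near_dist.
    rewrite ltr_norml => xy; case: (leP x y) => yx.
      rewrite (@ger0_norm _ (y - x)) ?subr_ge0//.
      have := H x y; apply; lra.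
    rewrite distrC (distrC y) (@ger0_norm _ (x - y)) ?subr_ge0 ?(ltW yx)//.
    rewrite normrM (distrC (N y)) -normrM.
    have := H y x; apply; lra.
split => // a b ab; rewrite HP.2//.
by have := is_derive_0_is_cst a b dF; rewrite /F; lra.
Unshelve. all: by end_near. Qed.

Lemma ae_eq_int_segment p q a b : loc_int p -> loc_int q ->
  {ae mu, forall x, p x = q x} ->
  \int[mu]_(x in `[a, b]) p x = \int[mu]_(x in `[a, b]) q x.
Proof.
move=> [mp _ _] [mq _ _] pq; rewrite /Rintegral; congr fine.
apply: ae_eq_integral => //.
- by apply/measurable_EFinP; exact: measurable_funTS.
- by apply/measurable_EFinP; exact: measurable_funTS.
- by apply: ae_imply pq => x ->.
Qed.

Lemma abs_cont_ae u p q : loc_int q -> {ae mu, forall x, p x = q x} ->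
  abs_cont u p -> abs_cont u q.
Proof.
move=> lq pq [lp Hp]; split => // a b ab.
by rewrite -Hp//; apply/esym/ae_eq_int_segment.
Qed.

End abs_cont_algebra.

(** * Test functions and weak derivatives *)

Section test_functions.
Variable R : realType.
Implicit Types (f g h u v p q : R -> R) (a b x k : R) (D : set R).
Local Notation mu := (@lebesgue_measure R).
Local Notation loc_int := (locally_integrable [set: R]).

Lemma smooth_step_exists : exists S S' : R -> R,
  [/\ forall x, is_derive x 1 S (S' x), continuous S',
      forall x, x <= 0 -> S x = 0, forall x, 1 <= x -> S x = 1 &
      forall x, 0 <= S x <= 1].
Proof.
(* A continuous bump on the unit interval, whose primitive is the step. *)
pose e x : R := Num.max 0 (x * (1 - x)).
have ce : continuous e.
  move=> x; apply: (@continuous_max R R (fun=> 0) (fun y => y * (1 - y)) x).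
    exact: cst_continuous.
  by apply: cvgM; [exact: cvg_id|apply: cvgB; [exact: cvg_cst|exact: cvg_id]].
have e0 x : 0 <= e x by rewrite le_max lexx.
have eE x : x <= 0 \/ 1 <= x -> e x = 0.
  by move=> xx; apply/max_idPl; case: xx => xx; nra.
have [P HP] := abs_cont_exists (continuous_loc_int ce).
have dP := abs_cont_is_derive HP ce.
have mP x y : x <= y -> P x <= P y.
  by move=> xy; rewrite -subr_ge0 -HP.2//; exact: int_segment_ge0.
have P0 x : x <= 0 -> P x = P 0.
  move=> x0; apply/esym/eqP; rewrite -subr_eq0 -HP.2//; apply/eqP.
  rewrite (@eq_Rintegral _ _ _ _ _ (fun=> 0)); first by rewrite int_segment_cst// mul0r.
  by move=> y; rewrite inE /= in_itv /= => /andP[_ y0]; apply: eE; left.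
have P1 x : 1 <= x -> P x = P 1.
  move=> x0; apply/eqP; rewrite -subr_eq0 -HP.2//; apply/eqP.
  rewrite (@eq_Rintegral _ _ _ _ _ (fun=> 0)); first by rewrite int_segment_cst// mul0r.
  by move=> y; rewrite inE /= in_itv /= => /andP[y0 _]; apply: eE; right.
have d0 : 0 < P 1 - P 0.
  have [||c] := @MVT R P e (1 / 4) (3 / 4) _ (fun x _ => dP x).
  - by lra.
  - exact/continuous_subspaceT/(is_derive_continuous dP).
  rewrite in_itv /= => /andP[c1 c2] H.
  have ec : 0 < e c by rewrite lt_max; apply/orP; right; nra.
  have : P (1 / 4) >= P 0 by apply: mP; lra.
  have : P (3 / 4) <= P 1 by apply: mP; lra.
  nra.
exists (fun x => (P 1 - P 0)^-1 * (P x - P 0)), (fun x => (P 1 - P 0)^-1 * e x).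
split.
- move=> x; apply: is_deriveZf; rewrite -[e x]subr0.
  exact: is_deriveBf.
- by move=> x; apply: cvgM; [exact: cvg_cst|exact: ce].
- by move=> x x0; rewrite (P0 x)// subrr mulr0.
- by move=> x x1; rewrite (P1 x)// mulVf// gt_eqF.
- move=> x; rewrite mulr_ge0 ?invr_ge0 ?(ltW d0)//=; last first.
    rewrite subr_ge0; case: (leP 0 x) => x0; first exact: mP.
    by rewrite (P0 x)// ltW.
  rewrite mulrC ler_pdivrMr// mul1r lerD2r.
  by case: (leP x 1) => x1; [exact: mP|rewrite (P1 x)// ltW].
Qed.

Let S : R -> R := sval (cid smooth_step_exists).
Let S' : R -> R := sval (cid (svalP (cid smooth_step_exists))).
Let HS : [/\ forall x, is_derive x 1 S (S' x), continuous S',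
      forall x, x <= 0 -> S x = 0, forall x, 1 <= x -> S x = 1 &
      forall x, 0 <= S x <= 1].
Proof. exact: (svalP (cid (svalP (cid smooth_step_exists)))). Qed.

(** A test function supported in [a, b] that converges to the indicator function
    of the open interval as [n] grows. *)
Let bump a b (n : nat) x := S (n%:R * (x + - a)) * S (- n%:R * (x + - b)).

Let bump' a b (n : nat) x :=
  (n%:R * S' (n%:R * (x + - a))) * S (- n%:R * (x + - b)) +
  S (n%:R * (x + - a)) * (- n%:R * S' (- n%:R * (x + - b))).

Let bump_is_derive a b n x : is_derive x 1 (bump a b n) (bump' a b n x).
Proof.
have [dS _ _ _ _] := HS.
apply: is_deriveMf.
- exact: (@is_derive_comp_affine _ S n%:R (- a)).
- exact: (@is_derive_comp_affine _ S (- n%:R) (- b)).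
Qed.

Let continuous_affine k c : continuous (fun x : R => k * (x + c)).
Proof.
by move=> x; apply: cvgM; [exact: cvg_cst|apply: cvgD; [exact: cvg_id|exact: cvg_cst]].
Qed.

Let bump'_continuous a b n : continuous (bump' a b n).
Proof.
have [dS cS' _ _ _] := HS.
have cS := is_derive_continuous dS.
have ca k c : continuous (fun x => S (k * (x + c))).
  by move=> x; apply: (@continuous_comp _ _ _ (fun y => k * (y + c)) S);
    [exact: continuous_affine|exact: cS].
have ca' k c : continuous (fun x => k * S' (k * (x + c))).
  move=> x; apply: cvgM; first exact: cvg_cst.
  by apply: (@continuous_comp _ _ _ (fun y => k * (y + c)) S');
    [exact: continuous_affine|exact: cS'].
move=> x; apply: cvgD; apply: cvgM; solve [exact: ca|exact: ca'].
Qed.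

Let bump_continuous a b n : continuous (bump a b n).
Proof. by apply: is_derive_continuous; exact: bump_is_derive. Qed.

Let bump_out a b n x : ~ (a <= x <= b) -> bump a b n x = 0.
Proof.
have [_ _ S0 _ _] := HS => xab; rewrite /bump.
case: (leP a x) => ax.
  have bx : b < x by rewrite ltNge; apply/negP => xb; apply: xab; rewrite ax.
  rewrite [X in _ * X]S0 ?mulr0// mulNr oppr_le0 mulr_ge0//.
  by rewrite subr_ge0 ltW.
by rewrite S0 ?mul0r// mulr_ge0_le0// subr_le0 ltW.
Qed.

Let bump_ge0 a b n x : 0 <= bump a b n x.
Proof.
have [_ _ _ _ S01] := HS.
by rewrite mulr_ge0//; [case/andP: (S01 (n%:R * (x - a)))|
  case/andP: (S01 (- n%:R * (x - b)))].
Qed.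

Let bump_le1 a b n x : bump a b n x <= 1.
Proof.
have [_ _ _ _ S01] := HS.
case/andP: (S01 (n%:R * (x - a))) => ? ?; case/andP: (S01 (- n%:R * (x - b))) => ? ?.
by rewrite mulr_ile1.
Qed.

Let bump_cvg a b x : a < x < b -> bump a b n x @[n --> \oo] --> (1 : R).
Proof.
have [_ _ _ S1 _] := HS => /andP[ax xb].
apply: cvg_near_cst; near=> n.
have n1 : (x - a)^-1 <= n%:R by near: n; exact: nbhs_infty_ger.
have n2 : (b - x)^-1 <= n%:R by near: n; exact: nbhs_infty_ger.
have xa0 : 0 < x - a by rewrite subr_gt0.
have xb0 : 0 < b - x by rewrite subr_gt0.
rewrite /bump !S1 ?mulr1//.
  by rewrite mulNr -mulrN opprB -ler_pdivrMr// mul1r.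
by rewrite -ler_pdivrMr// mul1r.
Unshelve. all: by end_near. Qed.

Let bump_test D a b n : `[a, b] `<=` D -> test_function D (bump a b n).
Proof.
move=> abD; split.
- by move=> x; case: (bump_is_derive a b n x).
- have -> : derive1 (bump a b n) = bump' a b n; last exact: bump'_continuous.
  by apply/funext => x; rewrite derive1E; have [_ ->] := bump_is_derive a b n x.
- exists `[a, b]%classic; split => //; first exact: segment_compact.
  by move=> x xab; apply: bump_out; move: xab; rewrite /= in_itv.
Qed.

Let int_bump_cvg h a b : a < b -> mu.-integrable `[a, b] (EFin \o h) ->
  \int[mu]_(x in `[a, b]) (h x * bump a b n x) @[n --> \oo] -->
  \int[mu]_(x in `[a, b]) h x.
Proof.
move=> ab ih.
have mh : measurable_fun `[a, b] h by apply/measurable_EFinP; case/integrableP: ih.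
have mb n : measurable_fun `[a, b] (bump a b n).
  by apply: measurable_funTS; apply: continuous_measurable_fun; exact: bump_continuous.
pose f_ (n : nat) x := (h x * bump a b n x)%:E.
have [] := @dominated_convergence _ _ _ mu `[a, b]%classic _ f_ (EFin \o h)
  (EFin \o (fun x => `|h x|)).
- by [].
- by move=> n; apply/measurable_EFinP; exact: (measurable_funM mh (mb n)).
- exact/measurable_EFinP.
- have : mu.-negligible ([set a] `|` [set b]).
    by apply: negligibleU; apply/negligibleP => //; exact: lebesgue_measure_set1.
  apply: negligibleS => x /= /not_implyP[]; rewrite /= in_itv /= => /andP[ax xb] H.
  case: (eqVneq x a) => [->|xa]; first by left.
  case: (eqVneq x b) => [->|xb']; first by right.
  exfalso; apply: H; apply: cvg_EFin; first exact: nearW.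
  rewrite -[X in _ --> X]mulr1; apply: cvgM; first exact: cvg_cst.
  by apply: bump_cvg; rewrite !lt_neqAle ax xb xb' eq_sym xa.
- by apply: integrable_norm.
- apply: aeW => x n _; rewrite lee_fin normrM ler_piMr//.
  by rewrite ger0_norm ?bump_le1// bump_ge0.
move=> _ _ H; rewrite /Rintegral.
by apply: fine_cvg; rewrite fineK//; exact: integrable_fin_num.
Qed.


Lemma int_support (D E : set R) f : (forall x, ~ (D x /\ E x) -> f x = 0) ->
  \int[mu]_(x in D) f x = \int[mu]_(x in E) f x.
Proof.
move=> f0; rewrite Rintegral_mkcond [RHS]Rintegral_mkcond.
apply: eq_Rintegral => x _; rewrite !patchE.
case: ifPn => xD; case: ifPn => xE //.
  by apply: f0 => -[_]; rewrite notin_setE in xE.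
by apply/esym/f0 => -[+ _]; rewrite notin_setE in xD.
Qed.

Let ae_zero_segment h a b : a < b -> mu.-integrable `[a, b] (EFin \o h) ->
  (forall y, a < y < b -> \int[mu]_(x in `[a, y]) h x = 0) ->
  {ae mu, forall x, a < x < b -> h x = 0}.
Proof.
move=> ab ih H.
pose f := h \_ `[a, b].
have lf : loc_int f by apply: integrable_locally_restrict.
have iy y : mu.-integrable `[a, y] (EFin \o f) by exact: loc_int_segment.
have := @FTC1 R f (BLeft a) iy lf; apply: ae_imply => x /= + /andP[ax xb].
rewrite lte_fin ax => /(_ isT)[_ D2].
have -> : h x = f x.
  by rewrite /f patchE mem_set//= in_itv /= !ltW.
rewrite -D2 derive1E.
rewrite (@near_eq_derive _ _ _ _ (fun=> 0)) ?derive_cst//.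
near=> y.
have : `|y - x| < Num.min (x - a) (b - x).
  by near: y; apply: near_dist; rewrite lt_min !subr_gt0 ax.
rewrite lt_min !ltr_norml => yx.
rewrite -(H y); last lra.
apply: eq_Rintegral => z; rewrite inE /= in_itv /= => /andP[az zy].
by rewrite /f patchE mem_set//= in_itv /= az; lra.
Unshelve. all: by end_near. Qed.

(** The integral from a fixed left end vanishes identically, hence so does its
    derivative, which is almost everywhere equal to [h]. Rational end points
    leave only countably many exceptional null sets. *)
Lemma ae_zero_of_int_segments D h : open D ->
  (forall a b, a < b -> `[a, b] `<=` D ->
    mu.-integrable `[a, b] (EFin \o h) /\ \int[mu]_(x in `[a, b]) h x = 0) ->
  {ae mu, forall x, D x -> h x = 0}.
Proof.
move=> oD H.
pose P (n : nat) x := match unpickle n with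
  | Some (q1, q2) => (ratr q1 < ratr q2 :> R) ->
     `[ratr q1, ratr q2] `<=` D -> (ratr q1 < x < ratr q2) -> h x = 0
  | None => True end.
have HP n : {ae mu, forall x, P n x}.
  rewrite /P; case: (unpickle n) => [[q1 q2]|]; last exact: aeW.
  case: (pselect ((ratr q1 < ratr q2 :> R) /\ `[ratr q1, ratr q2] `<=` D)) => [[q12 qD]|nq].
    have [ih _] := H _ _ q12 qD.
    have /(ae_zero_segment q12 ih) : forall y, ratr q1 < y < ratr q2 ->
        \int[mu]_(x in `[ratr q1, y]) h x = 0.
      move=> y /andP[q1y yq2]; have [|_ ->//] := H (ratr q1) y q1y.
      by apply: subset_trans qD => z /=; rewrite !in_itv /=; lra.
    by apply: ae_imply => x + _ _.
  by apply: aeW => x q12 qD; case: nq.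
have := ae_foralln HP; apply: ae_imply => x Hx Dx.
have /nbhs_ballP[e /= e0 eD] := open_nbhs_nbhs (conj oD Dx).
have [q1 q1x] : exists q : rat, ratr q \in `]x - e, x[%R.
  by apply: rat_in_itvoo; lra.
have [q2 q2x] : exists q : rat, ratr q \in `]x, x + e[%R.
  by apply: rat_in_itvoo; lra.
move: q1x q2x; rewrite !in_itv /= => q1x q2x.
have := Hx (pickle (q1, q2)); rewrite /P pickleK; apply; try lra.
move=> z /=; rewrite in_itv /= => zq; apply: eD.
by rewrite /ball /= ltr_norml; lra.
Qed.

Lemma derive_outside_support (phi : R -> R) (K : set R) x : compact K ->
  (forall y, ~ K y -> phi y = 0) -> ~ K x -> derive1 phi x = 0.
Proof.
move=> cK H Kx; rewrite derive1E.
rewrite (@near_eq_derive _ _ _ _ (fun=> 0)) ?derive_cst//.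
have oK : open (~` K) by apply: closed_openC; exact: compact_closed.
have := open_nbhs_nbhs (conj oK Kx).
by apply: filterS => y /H.
Qed.

Lemma integrable_test D (phi : R -> R) (K : set R) h : compact K -> K `<=` D ->
  continuous phi -> (forall y, ~ K y -> phi y = 0) ->
  locally_integrable D h -> mu.-integrable D (EFin \o (fun x => h x * phi x)).
Proof.
move=> cK KD cphi phi0 [mh oD Hh].
have mD := open_measurable oD.
have mK := compact_measurable cK.
have -> : EFin \o (fun x => h x * phi x) = (EFin \o (fun x => h x * phi x)) \_ K.
  apply/funext => x; rewrite patchE; case: ifPn => //.
  by rewrite notin_setE /= => /phi0 ->; rewrite mulr0.
apply/integrable_restrict => //; rewrite setIidr//.
have -> : EFin \o (fun x => h x * phi x) = ((EFin \o phi) \* (EFin \o h))%E.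
  by apply/funext => x /=; rewrite mulrC EFinM.
apply: integrableMr => //.
- by apply: measurable_funTS; exact: continuous_measurable_fun.
- have [M M0 KM] := compact_sub_segment cK.
  have [N N0 HN] := @continuous_segment_bounded _ phi (- M) M cphi.
  exists N; split; first exact: num_real.
  move=> x Nx y Ky; apply: (le_trans _ (ltW Nx)); apply: HN.
  by have := KM _ Ky; rewrite /= in_itv.
- apply/integrableP; split; last exact: Hh.
  by apply/measurable_EFinP; exact: measurable_funS mh.
Qed.

(** The fundamental lemma of the calculus of variations: bumps converge to the
    indicator function of any segment inside [D]. *)
Lemma test_function_ae_zero D h : locally_integrable D h ->
  (forall phi, test_function D phi -> \int[mu]_(x in D) (h x * phi x) = 0) ->
  {ae mu, forall x, D x -> h x = 0}.
Proof.
move=> lh H; have [mh oD Hh] := lh.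
apply: ae_zero_of_int_segments => // a b ab abD.
have ih : mu.-integrable `[a, b] (EFin \o h).
  apply/integrableP; split; last by apply: Hh => //; exact: segment_compact.
  by apply/measurable_EFinP; apply: measurable_funS mh => //; exact: open_measurable.
split => //.
have := int_bump_cvg ab ih.
under eq_fun => n.
  rewrite (_ : \int[mu]_(x in _) _ = 0); last first.
    rewrite -(H _ (bump_test n abD)); apply/esym/int_support => x xab.
    rewrite [X in _ * X]bump_out ?mulr0// => xin; apply: xab; split.
      by apply: abD; rewrite /= in_itv.
    by rewrite /= in_itv.
  over.
by move=> /(cvg_unique _ (cvg_cst 0)) <-.
Qed.


Lemma abs_cont_weak_derivative D u p : open D -> abs_cont u p ->
  is_weak_derivative D u p.
Proof.
move=> oD Hu; have cu := abs_cont_continuous Hu; split.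
- exact: (loc_int_sub oD (continuous_loc_int cu)).
- by apply: loc_int_sub => //; case: Hu.
move=> phi [dphi cphi' [K [cK KD phi0]]].
have dphi' x : is_derive x 1 phi (derive1 phi x).
  by rewrite derive1E; split.
have cphi := is_derive_continuous dphi'.
have [M M0 KM] := compact_sub_segment cK.
have KM1 : K `<=` `[- (M + 1), M + 1].
  by move=> x /KM; rewrite /= !in_itv /=; lra.
have [lh Hh] := abs_contM dphi' cphi' Hu.
have := Hh (- (M + 1)) (M + 1) ltac:(lra).
rewrite !phi0 ?mul0r ?subrr; first last.
- by move=> /KM; rewrite /= in_itv /=; lra.
- by move=> /KM; rewrite /= in_itv /=; lra.
rewrite int_segmentD; first last.
- by apply: loc_intM => //; case: Hu.
- by apply: loc_intM => //; exact: continuous_loc_int.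
rewrite (@int_support D `[- (M + 1), M + 1] (fun x => u x * derive1 phi x)); last first.
  move=> x xK; rewrite (derive_outside_support cK phi0) ?mulr0// => Kx.
  by apply: xK; split; [exact: KD|exact: KM1].
rewrite (@int_support D `[- (M + 1), M + 1] (fun x => p x * phi x)); last first.
  move=> x xK; rewrite phi0 ?mulr0// => Kx.
  by apply: xK; split; [exact: KD|exact: KM1].
do 2 under eq_Rintegral do rewrite mulrC.
move=> /eqP; rewrite addr_eq0 => /eqP ->; congr (- _).
by apply: eq_Rintegral => x _; rewrite mulrC.
Qed.

Lemma weak_derivative_ae D v v' g : locally_integrable D v' ->
  {ae mu, forall x, D x -> v x = v' x} ->
  is_weak_derivative D v g -> is_weak_derivative D v' g.
Proof.
move=> [mv' oD Hv'] vv' [[mv _ _] lg H]; split => // phi tphi.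
have mD := open_measurable oD.
rewrite -H//; rewrite /Rintegral; congr fine.
have mphi' : measurable_fun D (derive1 phi).
  by case: tphi => _ cphi' _; apply: measurable_funTS; exact: continuous_measurable_fun.
apply: ae_eq_integral => //.
- by apply/measurable_EFinP; exact: measurable_funM.
- by apply/measurable_EFinP; exact: measurable_funM.
- by apply: ae_imply vv' => x + Dx => ->.
Qed.

Lemma weak_derivative_unique D v g g' :
  is_weak_derivative D v g -> is_weak_derivative D v g' ->
  {ae mu, forall x, D x -> g x = g' x}.
Proof.
move=> [_ lg Hg] [_ lg' Hg'].
have oD : open D by case: lg.
have : {ae mu, forall x, D x -> (g \- g') x = 0}.
  apply: test_function_ae_zero; first exact: locally_integrableB.
  move=> phi tphi; have [dphi cphi' [K [cK KD phi0]]] := tphi.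
  have cphi : continuous phi.
    apply: (@is_derive_continuous _ _ (derive1 phi)) => x.
    by rewrite derive1E; split.
  under eq_Rintegral do rewrite /= mulrBl.
  rewrite RintegralB; [|exact: open_measurable
    |exact: (integrable_test cK KD cphi phi0 lg)
    |exact: (integrable_test cK KD cphi phi0 lg')].
  by apply/eqP; rewrite subr_eq0 -eqr_opp -Hg// -Hg'.
by apply: ae_imply => x H Dx; apply/eqP; rewrite -subr_eq0; apply/eqP; exact: H.
Qed.

(** A function with vanishing weak derivative is orthogonal to every continuous
    bump of zero mean, since such a bump is the derivative of a test function.
    Hence its integral over a segment is proportional to the length. *)
Lemma weak_derivative_abs_cont v g : is_weak_derivative [set: R] v g ->
  exists2 u, abs_cont u g & {ae mu, forall x, v x = u x}.
Proof.
move=> [lv lg Hv].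
have [G HG] := abs_cont_exists lg.
have [lG _ HGw] := abs_cont_weak_derivative (openT : open [set: R]) HG.
pose m x := v x - G x.
have lm : loc_int m by exact: locally_integrableB.
have Hm phi : test_function [set: R] phi ->
    \int[mu]_x (m x * derive1 phi x) = 0.
  move=> tphi; have [dphi cphi' [K [cK KD phi0]]] := tphi.
  under eq_Rintegral do rewrite /= mulrBl.
  have phi'0 := derive_outside_support cK phi0.
  rewrite RintegralB; [|by []|exact: (integrable_test cK KD cphi' phi'0 lv)
    |exact: (integrable_test cK KD cphi' phi'0 lG)].
  by rewrite Hv// HGw// subrr.
have Hpsi (psi : R -> R) (M : R) : 0 < M -> continuous psi ->
    (forall x, ~ (- M < x < M) -> psi x = 0) ->
    \int[mu]_(x in `[- M, M]) psi x = 0 ->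
    \int[mu]_(x in `[- M, M]) (m x * psi x) = 0.
  move=> M0 cpsi psi0 ipsi.
  have [P HP] := abs_cont_exists (continuous_loc_int cpsi).
  have dP := abs_cont_is_derive HP cpsi.
  pose phi x := P x - P (- M).
  have dphi x : is_derive x 1 phi (psi x).
    by rewrite -[psi x]subr0; exact: is_deriveBf.
  have phi'E : derive1 phi = psi.
    by apply/funext => x; rewrite derive1E; have [_ ->] := dphi x.
  rewrite -(@int_support [set: R] `[- M, M]); last first.
    move=> x xM; rewrite psi0 ?mulr0// => xin; apply: xM; split => //.
    by rewrite /= in_itv /=; lra.
  rewrite -phi'E; apply: Hm; split.
  - by move=> x; case: (dphi x).
  - by rewrite phi'E.
  exists `[- M, M]%classic; split => //; first exact: segment_compact.
  move=> x; rewrite /= in_itv /= => xM; rewrite /phi; case: (leP x (- M)) => xN.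
    apply/eqP; rewrite -oppr_eq0 opprB -HP.2//; apply/eqP.
    rewrite (@eq_Rintegral _ _ _ _ _ (fun=> 0)); first by rewrite int_segment_cst// mul0r.
    by move=> y; rewrite inE /= in_itv /= => yM; apply: psi0; lra.
  have Mx : M < x by rewrite ltNge; apply/negP => xM'; apply: xM; rewrite (ltW xN).
  rewrite -HP.2 ?ltW// (@int_chasles _ _ _ _ M) ?ltW//; last 2 first.
  - exact: continuous_loc_int.
  - by lra.
  rewrite ipsi add0r (@eq_Rintegral _ _ _ _ _ (fun=> 0)).
    by rewrite int_segment_cst ?ltW// mul0r.
  by move=> y; rewrite inE /= in_itv /= => yM; apply: psi0; lra.
have l1 : loc_int (fun=> 1) by apply: continuous_loc_int; exact: cst_continuous.
have l01 : (0 : R) < 1 by [].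
have lb a b n : loc_int (bump a b n) by apply: continuous_loc_int; exact: bump_continuous.
have [n0 J0] : exists n0, 0 < \int[mu]_(x in `[0, 1]) bump 0 1 n0 x.
  have := int_bump_cvg l01 (loc_int_segment 0 1 l1).
  rewrite int_segment_cst// subr0 mulr1.
  under eq_fun do under eq_Rintegral do rewrite mul1r.
  move=> /(cvgr_gt (1 : R)) /(_ 0 l01) [N _ HN].
  by exists N; apply: HN => /=.
set J := \int[mu]_(x in _) _ in J0.
pose b0 := bump 0 1 n0.
pose C := (\int[mu]_(x in `[0, 1]) (m x * b0 x)) / J.
have key a b : a < b -> \int[mu]_(x in `[a, b]) m x = C * (b - a).
  move=> ab.
  have E n : \int[mu]_(x in `[a, b]) (m x * bump a b n x) =
             C * \int[mu]_(x in `[a, b]) (1 * bump a b n x).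
    (* Large enough to enclose both [a, b] and [0, 1]. *)
    pose M : R := `|a| + `|b| + 2.
    have aM : - M < a /\ b < M.
      have := ler_norm b; have := ler_norm (- a); rewrite normrN /M.
      by have := normr_ge0 a; have := normr_ge0 b; lra.
    have M1 : 1 < M by have := normr_ge0 a; have := normr_ge0 b; rewrite /M; lra.
    pose I := \int[mu]_(x in `[a, b]) bump a b n x.
    (* The multiple of [b0] makes the mean of [psi] vanish. *)
    pose psi x := bump a b n x - I / J * b0 x.
    have sb f (c d : R) (j : nat) : - M <= c -> d <= M ->
      \int[mu]_(x in `[- M, M]) (f x * bump c d j x) =
      \int[mu]_(x in `[c, d]) (f x * bump c d j x).
      move=> Mc dM; apply: int_support => x xx.
      rewrite bump_out ?mulr0// => /andP[cx xd]; apply: xx.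
      by rewrite /= !in_itv /=; lra.
    have sb1 (c d : R) (j : nat) : - M <= c -> d <= M ->
      \int[mu]_(x in `[- M, M]) (bump c d j x) = \int[mu]_(x in `[c, d]) (bump c d j x).
      move=> Mc dM; apply: int_support => x xx.
      rewrite bump_out// => /andP[cx xd]; apply: xx.
      by rewrite /= !in_itv /=; lra.
    have lmb (c d : R) (j : nat) : loc_int (fun x => m x * bump c d j x).
      under eq_fun do rewrite mulrC.
      by apply: loc_intM => //; exact: bump_continuous.
    have := @Hpsi psi M ltac:(lra) _ _ _.
    have -> : \int[mu]_(x in `[(- M), M]) (m x * psi x) =
      \int[mu]_(x in `[a, b]) (m x * bump a b n x) - I / J * \int[mu]_(x in `[0, 1]) (m x * b0 x).
      under eq_Rintegral do rewrite mulrBr [X in _ - X]mulrCA.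
      rewrite int_segmentB//; last by apply: loc_intZ; exact: lmb.
      rewrite int_segmentZ; last exact: lmb.
      by rewrite !sb//; lra.
    move=> H; apply/eqP; rewrite -subr_eq0; apply/eqP; rewrite -H.
    - have -> : \int[mu]_(x in `[a, b]) (1 * bump a b n x) = I.
        by apply: eq_Rintegral => x _; rewrite mul1r.
      by rewrite /C; field; rewrite gt_eqF.
    - move=> x; apply: cvgB; first exact: bump_continuous.
      by apply: cvgM; [exact: cvg_cst|exact: bump_continuous].
    - move=> x xM; rewrite /psi /b0 !bump_out ?mulr0 ?subrr// => xx; apply: xM; lra.
    - rewrite int_segmentB; [|exact: lb|exact: (loc_intZ _ (lb 0 1 n0))].
      rewrite int_segmentZ; last exact: lb.
      by rewrite /b0 !sb1 -/J -/I; try lra; rewrite divfK ?subrr// gt_eqF.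
  have c1 := int_bump_cvg ab (loc_int_segment a b lm).
  have c2 : C * \int[mu]_(x in `[a, b]) (1 * bump a b n x) @[n --> \oo] -->
      C * \int[mu]_(x in `[a, b]) (1 : R).
    apply: cvgM; first exact: cvg_cst.
    exact: (int_bump_cvg ab (loc_int_segment a b l1)).
  rewrite (_ : (fun n => _) = (fun n => C * \int[mu]_(x in `[a, b]) (1 * bump a b n x))) in c1;
    last by apply/funext => n; exact: E.
  by rewrite (cvg_unique _ c1 c2)// int_segment_cst ?(ltW ab)// mul1r.
exists (fun x => G x + C).
  split; first by case: HG.
  by move=> a b ab; rewrite HG.2//; ring.
have : {ae mu, forall x, [set: R] x -> m x - C = 0}.
  apply: ae_zero_of_int_segments; first exact: openT.
  move=> a b ab _; have lC : loc_int (fun=> C) by apply: continuous_loc_int; exact: cst_continuous.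
  split; first by apply: loc_int_segment; exact: locally_integrableB.
  by rewrite int_segmentB// key// int_segment_cst ?ltW// subrr.
by apply: ae_imply => x /(_ I); rewrite /m; lra.
Unshelve. all: by end_near. Qed.

End test_functions.

(** * The space H^2_loc *)

(** Membership of [u] in [H^2_loc] with its derivatives as data. The chosen weak
    derivative is only defined almost everywhere, whereas the classical
    derivative [p] can be estimated pointwise and composed with translations. *)
Definition H2rep (R : realType) (u p g : R -> R) : Prop :=
  [/\ forall x : R, is_derive x 1 u (p x), abs_cont p g &
      locally_integrable [set: R] (fun x => g x ^+ 2)].

Section H2rep.
Variable R : realType.
Implicit Types (f g h u v p q : R -> R) (a b x k : R) (D : set R).
Local Notation mu := (@lebesgue_measure R).
Local Notation loc_int := (locally_integrable [set: R]).

Lemma wderivP D u : weakly_derivable D u -> is_weak_derivative D u (wderiv D u).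
Proof. by move=> Hu; exact: xgetPex. Qed.

Lemma wderiv_ae D u g : is_weak_derivative D u g ->
  {ae mu, forall x, D x -> wderiv D u x = g x}.
Proof.
by move=> ug; apply: (weak_derivative_unique _ ug); apply: wderivP; exists g.
Qed.

Lemma continuous_ae_eq u v : continuous u -> continuous v ->
  {ae mu, forall x, u x = v x} -> u =1 v.
Proof.
move=> cu cv uv.
have ch : continuous (fun x => u x - v x).
  by move=> x; apply: cvgB; [exact: cu|exact: cv].
have A : abs_cont (fun=> 0) (fun x => u x - v x).
  split; first exact: continuous_loc_int.
  move=> a b ab; rewrite subrr (@ae_eq_int_segment _ _ (fun=> 0)).
  - by rewrite int_segment_cst// mul0r.
  - exact: continuous_loc_int.
  - by apply: continuous_loc_int; exact: cst_continuous.
  - by apply: ae_imply uv => x ->; rewrite subrr.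
move=> x; have [_ E] := abs_cont_is_derive A ch x.
by apply/eqP; rewrite -subr_eq0 -E derive_cst.
Qed.

(** The first weak derivative agrees almost everywhere with an absolutely
    continuous [p]; the continuous representative [u] is then a primitive of [p]
    everywhere. *)
Lemma H2loc_rep u : H2loc u -> exists p, H2rep u p (wderivn [set: R] 2 u).
Proof.
move=> [cu W L2u].
have W1 := wderivP (W 0 isT); have W2 := wderivP (W 1 isT).
rewrite /= in W1 W2.
have [U HU uU] := weak_derivative_abs_cont W1.
have {}uU := continuous_ae_eq cu (abs_cont_continuous HU) uU.
have [p Hp g1p] := weak_derivative_abs_cont W2.
have cp := abs_cont_continuous Hp.
exists p; split => //.
- have -> : u = U by exact/funext.
  apply: abs_cont_is_derive => //.
  by apply: (abs_cont_ae _ g1p) => //; exact: continuous_loc_int.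
have [[mg _ _] _] := Hp.
split; [exact: measurable_funX|exact: openT|move=> K _ cK].
have [_] := L2u 2 isT K cK; apply: le_lt_trans.
rewrite le_eqVlt; apply/orP; left; apply/eqP.
by apply: eq_integral => x _; rewrite ger0_norm// sqr_ge0.
Qed.

(** Weak derivatives on [D] only see the restriction to [D]: a function [v] that
    is singular elsewhere may be replaced by a regular extension [u]. *)
Lemma H2rep_wderivn D u v p g : open D -> H2rep u p g ->
  (forall x, D x -> v x = u x) ->
  [/\ weakly_derivable D v, weakly_derivable D (wderiv D v),
      {ae mu, forall x, D x -> wderivn D 1 v x = p x} &
      {ae mu, forall x, D x -> wderivn D 2 v x = g x}].
Proof.
move=> oD [du Hp lg2] vu.
have cp := abs_cont_continuous Hp.
have cu := is_derive_continuous du.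
have mD := open_measurable oD.
have lv : locally_integrable D v.
  have [mu' _ Hu'] := loc_int_sub oD (continuous_loc_int cu).
  split => //; first by apply: eq_measurable_fun mu' => x; rewrite inE => /vu.
  move=> K KD cK; apply: le_lt_trans (Hu' K KD cK).
  rewrite le_eqVlt; apply/orP; left; apply/eqP/eq_integral => x.
  by rewrite inE => /KD /vu ->.
have wu := abs_cont_weak_derivative oD (C1_abs_cont du cp).
have wv : is_weak_derivative D v p.
  by apply: (weak_derivative_ae lv _ wu); apply: aeW => x /vu.
have pw := wderiv_ae wv.
have [_ lw _] := wderivP (ex_intro _ _ wv).
have wg : is_weak_derivative D (wderiv D v) g.
  apply: (weak_derivative_ae lw _ (abs_cont_weak_derivative oD Hp)).
  by apply: ae_imply pw => x H /H.
split => //; [by exists p|by exists g|exact: wderiv_ae wg].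
Qed.

Lemma L2_ae D f f' : measurable D -> measurable_fun D f ->
  {ae mu, forall x, D x -> f x = f' x} -> measurable_fun D f' ->
  (\int[mu]_(x in D) ((f' x) ^+ 2)%:E < +oo)%E -> L2 D f.
Proof.
move=> mD mf ff' mf' H; split => //; apply: le_lt_trans H.
rewrite le_eqVlt; apply/orP; left; apply/eqP/ae_eq_integral => //.
- by apply/measurable_EFinP; exact: measurable_funX.
- by apply/measurable_EFinP; exact: measurable_funX.
- by apply: ae_imply ff' => x H Dx; rewrite H.
Qed.

Lemma loc_int_sqr_lty f K : loc_int (fun x => f x ^+ 2) -> compact K ->
  (\int[mu]_(x in K) ((f x) ^+ 2)%:E < +oo)%E.
Proof.
move=> [_ _ H] cK; have := H K (@subsetT _ K) cK; apply: le_lt_trans.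
rewrite le_eqVlt; apply/orP; left; apply/eqP.
by apply: eq_integral => x _; rewrite ger0_norm// sqr_ge0.
Qed.

Lemma continuous_sqr f : continuous f -> continuous (fun x => f x ^+ 2).
Proof.
move=> cf; under eq_fun do rewrite expr2.
by move=> x; apply: cvgM; exact: cf.
Qed.

Lemma continuous_sqr_loc_int f : continuous f -> loc_int (fun x => f x ^+ 2).
Proof.
by move=> cf; apply: continuous_loc_int; exact: continuous_sqr.
Qed.

Lemma H2rep_H2loc u p g : H2rep u p g ->
  H2loc u /\ {ae mu, forall x, wderivn [set: R] 2 u x = g x}.
Proof.
move=> Hu; have [du Hp lg2] := Hu.
have cp := abs_cont_continuous Hp.
have cu := is_derive_continuous du.
have [w0 w1 e1 e2] := H2rep_wderivn openT Hu (fun x _ => erefl (u x)).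
split; last by apply: ae_imply e2 => x; exact.
split => //.
- by move=> [_|[_|l H]]; [exact: w0|exact: w1|exfalso; move: H; rewrite !ltnS ltn0].
- have [_ [m1 _ _] _] := wderivP w0.
  have [_ [m2 _ _] _] := wderivP w1.
  have [[mg _ _] _] := Hp.
  move=> [|[|[|]]]// _ K cK; have mK := compact_measurable cK.
  + split; last exact: loc_int_sqr_lty (continuous_sqr_loc_int cu) cK.
    by apply: measurable_funTS; exact: continuous_measurable_fun.
  + apply: (@L2_ae K _ p) => //.
    * exact: measurable_funTS.
    * by apply: ae_imply e1 => x H _; exact: H.
    * by apply: measurable_funTS; exact: continuous_measurable_fun.
    * exact: loc_int_sqr_lty (continuous_sqr_loc_int cp) cK.
  + apply: (@L2_ae K _ g) => //.
    * exact: measurable_funTS.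
    * by apply: ae_imply e2 => x H _; exact: H.
    * exact: measurable_funTS.
    * exact: loc_int_sqr_lty.
Qed.

Lemma loc_int_le f g : measurable_fun [set: R] f ->
  (forall x, `|f x| <= g x) -> loc_int g -> loc_int f.
Proof.
move=> mf fg [mg oT H]; split => // K _ cK.
apply: le_lt_trans (H K (@subsetT _ K) cK).
apply: ge0_le_integral => //.
- exact: compact_measurable.
- by apply/measurable_EFinP/measurableT_comp => //; exact: measurable_funTS.
- by apply/measurable_EFinP/measurableT_comp => //; exact: measurable_funTS.
- by move=> x _; rewrite lee_fin (le_trans (fg x))// ler_norm.
Qed.

Lemma loc_int_sqrD f g : loc_int f -> loc_int g ->
  loc_int (fun x => f x ^+ 2) -> loc_int (fun x => g x ^+ 2) ->
  loc_int (fun x => (f x + g x) ^+ 2).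
Proof.
move=> [mf _ _] [mg _ _] lf lg.
apply: (@loc_int_le _ (fun x => 2 * f x ^+ 2 + 2 * g x ^+ 2)).
- by apply: measurable_funX; exact: measurable_funD.
- by move=> x; rewrite ger0_norm ?sqr_ge0//; have := sqr_ge0 (f x - g x); nra.
- by apply: locally_integrableD; exact: loc_intZ.
Qed.

Lemma loc_int_sqrM f g : continuous f ->
  loc_int (fun x => g x ^+ 2) -> loc_int (fun x => (f x * g x) ^+ 2).
Proof.
move=> cf lg; under eq_fun do rewrite exprMn.
by apply: loc_intM => //; exact: continuous_sqr.
Qed.

Lemma H2repD u p g v q h : H2rep u p g -> H2rep v q h ->
  H2rep (fun x => u x + v x) (fun x => p x + q x) (fun x => g x + h x).
Proof.
move=> [du Hp lg] [dv Hq lh]; split.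
- by move=> x; exact: is_deriveDf.
- exact: abs_contD.
- by apply: loc_int_sqrD => //; [case: Hp|case: Hq].
Qed.

Lemma H2repZ k u p g : H2rep u p g ->
  H2rep (fun x => k * u x) (fun x => k * p x) (fun x => k * g x).
Proof.
move=> [du Hp lg]; split.
- by move=> x; exact: is_deriveZf.
- exact: abs_contZ.
- by apply: loc_int_sqrM => //; exact: cst_continuous.
Qed.

Lemma H2repB u p g v q h : H2rep u p g -> H2rep v q h ->
  H2rep (fun x => u x - v x) (fun x => p x - q x) (fun x => g x - h x).
Proof.
move=> Hu /(H2repZ (-1)) /(H2repD Hu).
by congr H2rep; apply/funext => x; rewrite mulN1r.
Qed.

Lemma H2rep_translate k u p g : H2rep u p g ->
  H2rep (fun x => u (x + k)) (fun x => p (x + k)) (fun x => g (x + k)).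
Proof.
move=> [du Hp lg]; split.
- by move=> x; exact: is_derive_shift.
- exact: abs_cont_translate.
- exact: (loc_int_translate k lg).
Qed.

Lemma H2repM f f1 f2 u p g :
  (forall x, is_derive x 1 f (f1 x)) -> (forall x, is_derive x 1 f1 (f2 x)) ->
  continuous f2 -> H2rep u p g ->
  H2rep (fun x => f x * u x) (fun x => f1 x * u x + f x * p x)
        (fun x => f2 x * u x + 2 * f1 x * p x + f x * g x).
Proof.
move=> df df1 cf2 [du Hp lg].
have cp := abs_cont_continuous Hp; have cu := is_derive_continuous du.
have cf := is_derive_continuous df; have cf1 := is_derive_continuous df1.
have c1 : continuous (fun x => f2 x * u x + 2 * f1 x * p x).
  move=> x; apply: cvgD; apply: cvgM; [exact: cf2|exact: cu| |exact: cp].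
  by apply: cvgM; [exact: cvg_cst|exact: cf1].
split.
- by move=> x; exact: is_deriveMf.
- have H1 := abs_contM df1 cf2 (C1_abs_cont du cp).
  have H2 := abs_contM df cf1 Hp.
  have := abs_contD H1 H2.
  by congr abs_cont; apply/funext => x; ring.
- apply: loc_int_sqrD.
  + exact: continuous_loc_int.
  + by apply: loc_intM => //; case: Hp.
  + exact: continuous_sqr_loc_int.
  + exact: loc_int_sqrM.
Qed.

Lemma C2_H2rep f f1 f2 :
  (forall x, is_derive x 1 f (f1 x)) -> (forall x, is_derive x 1 f1 (f2 x)) ->
  continuous f2 -> H2rep f f1 f2.
Proof.
move=> df df1 cf2; split => //; first exact: C1_abs_cont.
exact: continuous_sqr_loc_int.
Qed.

End H2rep.

(** * A lower bound for pi *)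

Section pi_bound.
Variable R : realType.

Let ge0_of_derive (f f' : R -> R) : (forall x : R, is_derive x 1 f (f' x)) ->
  f 0 = 0 -> (forall x, 0 <= x -> 0 <= f' x) -> forall x, 0 <= x -> 0 <= f x.
Proof.
move=> df f0 f'0 x x0.
have [|y] := @MVT_segment R f f' 0 x x0 (fun y _ => df y).
  exact/continuous_subspaceT/(is_derive_continuous df).
rewrite in_itv /= f0 !subr0 => /andP[y0 _] ->.
by rewrite mulr_ge0// f'0.
Qed.

Let is_deriveXf n (x : R) : is_derive x 1 (fun y => y ^+ n) (n%:R * x ^+ n.-1).
Proof.
have := @is_deriveX R R id n x 1 1 (is_derive_id x 1).
rewrite /GRing.scale /= mulr1.
have -> // : (id : R -> R) ^+ n = (fun y => y ^+ n).
by apply/funext => y; rewrite fctE.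
Qed.

Let is_deriveZX k n (x : R) :
  is_derive x 1 (fun y => k * y ^+ n) (k * (n%:R * x ^+ n.-1)).
Proof. exact: (is_deriveZf k (is_deriveXf n x)). Qed.

Ltac der := repeat first [exact: is_deriveZX | exact: is_derive_cst
  | exact: is_derive_cos | exact: is_derive_sin
  | apply: is_deriveBf | apply: is_deriveDf].

(** Successive integration of [cos x <= 1]. *)
Lemma cos_ge_taylor6 (x : R) : 0 <= x ->
  1 - x ^+ 2 / 2 + x ^+ 4 / 24 - x ^+ 6 / 720 <= cos x.
Proof.
move: x.
have s1 (x : R) : 0 <= x -> 0 <= 1 * x ^+ 1 - sin x.
  apply: (@ge0_of_derive (fun x => 1 * x ^+ 1 - sin x)
    (fun x => 1 * (1%:R * x ^+ 0) - cos x)).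
  - by move=> y; der.
  - by rewrite sin0 expr1; ring.
  - by move=> y _; have := cos_le1 y; rewrite expr0; lra.
have c2 (x : R) : 0 <= x -> 0 <= 2^-1 * x ^+ 2 + cos x - 1.
  apply: (@ge0_of_derive (fun x => 2^-1 * x ^+ 2 + cos x - 1)
    (fun x => 2^-1 * (2%:R * x ^+ 1) + - sin x - 0)).
  - by move=> y; der.
  - by rewrite cos0; ring.
  - by move=> y /s1; rewrite expr1; lra.
have s3 (x : R) : 0 <= x -> 0 <= 6^-1 * x ^+ 3 + sin x - 1 * x ^+ 1.
  apply: (@ge0_of_derive (fun x => 6^-1 * x ^+ 3 + sin x - 1 * x ^+ 1)
    (fun x => 6^-1 * (3%:R * x ^+ 2) + cos x - 1 * (1%:R * x ^+ 0))).
  - by move=> y; der.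
  - by rewrite sin0; ring.
  - by move=> y /c2; rewrite expr0; lra.
have c4 (x : R) : 0 <= x -> 0 <= 24^-1 * x ^+ 4 - 2^-1 * x ^+ 2 - cos x + 1.
  apply: (@ge0_of_derive (fun x => 24^-1 * x ^+ 4 - 2^-1 * x ^+ 2 - cos x + 1)
    (fun x => 24^-1 * (4%:R * x ^+ 3) - 2^-1 * (2%:R * x ^+ 1) - - sin x + 0)).
  - by move=> y; der.
  - by rewrite cos0; ring.
  - by move=> y /s3; rewrite expr1; lra.
have s5 (x : R) : 0 <= x -> 0 <= 120^-1 * x ^+ 5 - 6^-1 * x ^+ 3 - sin x + 1 * x ^+ 1.
  apply: (@ge0_of_derive (fun x => 120^-1 * x ^+ 5 - 6^-1 * x ^+ 3 - sin x + 1 * x ^+ 1)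
    (fun x => 120^-1 * (5%:R * x ^+ 4) - 6^-1 * (3%:R * x ^+ 2)
     - cos x + 1 * (1%:R * x ^+ 0))).
  - by move=> y; der.
  - by rewrite sin0; ring.
  - by move=> y /c4; rewrite expr0; lra.
have c6 (x : R) : 0 <= x ->
    0 <= 720^-1 * x ^+ 6 - 24^-1 * x ^+ 4 + 2^-1 * x ^+ 2 + cos x - 1.
  apply: (@ge0_of_derive (fun x => 720^-1 * x ^+ 6 - 24^-1 * x ^+ 4 + 2^-1 * x ^+ 2 + cos x - 1)
    (fun x => 720^-1 * (6%:R * x ^+ 5) - 24^-1 * (4%:R * x ^+ 3) +
     2^-1 * (2%:R * x ^+ 1) + - sin x - 0)).
  - by move=> y; der.
  - by rewrite cos0; ring.
  - by move=> y /s5; rewrite expr1; lra.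
by move=> x /c6; lra.
Qed.

(** The Taylor polynomial of the cosine is positive up to the square root of
    200/83, while the cosine vanishes at pi/2. *)
Lemma k0_sqr_gt : 200 / 83 < k0 R ^+ 2.
Proof.
have k1 : 1 <= k0 R by exact: pihalf_ge1.
rewrite ltNge; apply/negP => k2.
have := cos_ge_taylor6 (le_trans ler01 k1); rewrite /k0 cos_pihalf -/(k0 R).
have -> : k0 R ^+ 4 = (k0 R ^+ 2) ^+ 2 by rewrite -exprM.
have -> : k0 R ^+ 6 = (k0 R ^+ 2) ^+ 3 by rewrite -exprM.
have : 0 <= k0 R ^+ 2 by rewrite sqr_ge0.
by move: (k0 R ^+ 2) k2 => X; nra.
Qed.

End pi_bound.

(** * A Sobolev inequality *)

Section sobolev.
Variable R : realType.
Implicit Types (f g h u v p q : R -> R) (a b x k t : R) (D : set R).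
Local Notation mu := (@lebesgue_measure R).
Local Notation loc_int := (locally_integrable [set: R]).

Lemma le_young t a : 0 < t -> `|a| <= t / 2 + a ^+ 2 / (2 * t).
Proof.
move=> t0; rewrite -(ler_pM2r t0) -(@ler_pM2r _ 2)//.
have -> : (t / 2 + a ^+ 2 / (2 * t)) * t * 2 = t ^+ 2 + a ^+ 2.
  by field; rewrite gt_eqF.
have := sqr_ge0 (`|a| - t); rewrite -(real_normK (num_real a)); nra.
Qed.

(** The value at [x] differs from any value on [x, x + 1] by at most the
    integral of the norm of [p]; averaging and Young's inequality conclude. The
    parameter [t] replaces the square root of the Cauchy-Schwarz inequality. *)
Lemma sobolev_sup u p x t : abs_cont u p -> loc_int (fun y => p y ^+ 2) -> 0 < t ->
  `|u x| <= t + (\int[mu]_(y in `[x, x + 1]) (u y ^+ 2 + p y ^+ 2)) / (2 * t).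
Proof.
move=> Hu lp2 t0; have [lp Hp] := Hu.
have cu := abs_cont_continuous Hu.
have xx : x <= x + 1 by lra.
have lu := continuous_loc_int cu; have lu2 := continuous_sqr_loc_int cu.
have lnu := loc_int_norm lu; have lnp := loc_int_norm lp.
have lc k : loc_int (fun=> k) by apply: continuous_loc_int; exact: cst_continuous.
have H1 : `|u x| <= \int[mu]_(y in `[x, x + 1]) (`|u y| + `|p y|).
  rewrite int_segmentD//.
  set P := \int[mu]_(y in `[x, x + 1]) `|p y|.
  have -> : P = \int[mu]_(y in `[x, x + 1]) P.
    by rewrite int_segment_cst//; ring.
  have -> : `|u x| = \int[mu]_(y in `[x, x + 1]) `|u x|.
    by rewrite int_segment_cst//; ring.
  rewrite -int_segmentD//; apply: le_int_segment => //.
    exact: locally_integrableD.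
  move=> y /andP[xy yx].
  have -> : u x = u y - (u y - u x) by ring.
  apply: (le_trans (ler_normB _ _)); rewrite lerD2l -Hp//.
  apply: (le_trans (le_norm_int _ _ lp)).
  rewrite /P (int_chasles lnp xy yx) lerDl.
  by apply: int_segment_ge0 => z _.
apply: (le_trans H1).
have -> : t + \int[mu]_(y in `[x, x + 1]) (u y ^+ 2 + p y ^+ 2) / (2 * t) =
  \int[mu]_(y in `[x, x + 1]) (t + (2 * t)^-1 * (u y ^+ 2 + p y ^+ 2)).
  rewrite [RHS]int_segmentD//; last by apply: loc_intZ; exact: locally_integrableD.
  rewrite int_segment_cst// [in RHS]int_segmentZ; last exact: locally_integrableD.
  by rewrite [(2 * t)^-1 * _]mulrC; ring.
apply: le_int_segment.
- exact: locally_integrableD.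
- by apply: locally_integrableD => //; apply: loc_intZ; exact: locally_integrableD.
- move=> y _; have := le_young (u y) t0; have := le_young (p y) t0.
  set A := `|u y|; set B := `|p y|.
  rewrite mulrDr ![(2 * t)^-1 * _]mulrC; lra.
Qed.

Lemma int_tail_cvg0 q e : mu.-integrable [set: R] (EFin \o q) ->
  (forall x, 0 <= q x) -> 0 < e ->
  exists X : R, forall x, X <= x -> \int[mu]_(y in `[x, x + 1]) q y <= e.
Proof.
move=> iq q0 e0.
have mq : measurable_fun [set: R] q by apply/measurable_EFinP; case/integrableP: iq.
pose f_ (n : nat) := EFin \o (q \_ `[n%:R, +oo[).
have mf_ n : measurable_fun [set: R] (q \_ `[n%:R, +oo[).
  by apply/(measurable_restrictT _ _).1 => //; exact: measurable_funTS.
have [] := @dominated_convergence _ _ _ mu [set: R] _ f_ (fun=> 0%E) (EFin \o q).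
- by [].
- by move=> n; apply/measurable_EFinP; exact: mf_.
- exact: measurable_cst.
- apply: aeW => x _; apply: cvg_near_cst; near=> n.
  rewrite /f_ /= patchE ifF//; apply/negbTE; rewrite notin_setE /= in_itv /= andbT.
  apply/negP; rewrite -ltNge.
  have : `|x| + 1 <= n%:R by near: n; exact: nbhs_infty_ger.
  by have := ler_norm x; lra.
- exact: iq.
- apply: aeW => x n _; rewrite lee_fin patchE; case: ifPn => _; last by rewrite normr0.
  by rewrite ger0_norm.
move=> _ _; rewrite integral0 => H.
have /fine_cvg H0 : (fun n => \int[mu]_x f_ n x)%E @ \oo --> (0 : R)%:E by exact: H.
have [N _ HN] := (cvgr_le (0 : R)) H0 e e0.
exists N%:R => x Nx; apply: le_trans (HN N (leqnn N)).
rewrite /= /f_ Rintegral_mkcond.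
apply: le_Rintegral => //.
- by rewrite -restrict_EFin; apply/integrable_restrict => //; rewrite setTI; apply: integrableS iq.
- by rewrite -restrict_EFin; apply/integrable_restrict => //; rewrite setTI; apply: integrableS iq.
- move=> y _; rewrite !patchE; case: ifPn; rewrite ?notin_setE ?inE /= !in_itv /= => yx.
    by rewrite ifT// inE /= in_itv /= andbT; lra.
  by case: ifPn => // _; rewrite ?q0.
Unshelve. all: by end_near. Qed.

End sobolev.

(** * The a priori estimate *)

Section apriori.
Variable R : realType.
Implicit Types (f g h u v p q r : R -> R) (a b x t : R) (D : set R).
Local Notation mu := (@lebesgue_measure R).
Local Notation loc_int := (locally_integrable [set: R]).
Local Notation k := (k0 R).

Lemma k0_gt0 : 0 < k. Proof. by rewrite /k0 divr_gt0// pi_gt0. Qed.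

Let sink a x : R := sin (k * (x + - a)).
Let cosk a x : R := cos (k * (x + - a)).

Let sink_is_derive a x : is_derive x 1 (sink a) (k * cosk a x).
Proof. exact: (@is_derive_comp_affine _ sin). Qed.

Let cosk_is_derive a x : is_derive x 1 (cosk a) (k * - sink a x).
Proof. exact: (@is_derive_comp_affine _ cos). Qed.

Let cosk_continuous a : continuous (cosk a).
Proof. exact: (is_derive_continuous (cosk_is_derive a)). Qed.

Let sink_continuous a : continuous (sink a).
Proof. exact: (is_derive_continuous (sink_is_derive a)). Qed.

Let cosk1 a x : cosk a (x + 1) = - sink a x.
Proof.
by rewrite /cosk (_ : k * _ = k * (x - a) + pi / 2) ?cosDpihalf// /k0; ring.
Qed.

Let coskN1 a x : cosk a (x - 1) = sink a x.
Proof.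
by rewrite /cosk (_ : k * _ = k * (x - a) - pi / 2) ?cosBpihalf// /k0; ring.
Qed.

(** The unit shifts of the cosine of frequency [k0] are opposite sines, so that
    testing the equation against a sine of this frequency produces an exact
    derivative up to the source term. *)
Lemma resonant_test c r p g f a : H2rep r p g -> loc_int f ->
  {ae mu, forall x,
    c ^+ 2 * g x - discrete_laplacian r x + alpha c * r x = f x} ->
  exists2 Q : R -> R, abs_cont Q (fun x => cosk a x * r x) &
    abs_cont (fun x => c ^+ 2 * (sink a x * p x - k * (cosk a x * r x))
                       + (Q (x + 1) - Q (x + -1)))
             (fun x => sink a x * f x).
Proof.
move=> [dr Hp _] lf Hf.
have cp := abs_cont_continuous Hp; have cr := is_derive_continuous dr.
have Hr := C1_abs_cont dr cp.
have ck b : continuous (fun x => k * cosk b x).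
  by move=> x; apply: cvgM; [exact: cvg_cst|exact: cosk_continuous].
have ck' b : continuous (fun x => k * - sink b x).
  by move=> x; apply: cvgM; [exact: cvg_cst|apply: cvgN; exact: sink_continuous].
have H1 := abs_contM (sink_is_derive a) (ck a) Hp.
have H2 := abs_contM (cosk_is_derive a) (ck' a) Hr.
have cq : continuous (fun x => cosk a x * r x).
  by move=> x; apply: cvgM; [exact: cosk_continuous|exact: cr].
have [Q HQ] := abs_cont_exists (continuous_loc_int cq).
exists Q => //.
have := abs_contD (abs_contZ (c ^+ 2) (abs_contB H1 (abs_contZ k H2)))
  (abs_contB (abs_cont_translate 1 HQ) (abs_cont_translate (-1) HQ)).
apply: abs_cont_ae; first by apply: loc_intM => //; exact: sink_continuous.
apply: ae_imply Hf => x <-; rewrite cosk1 coskN1 /discrete_laplacian /alpha /k0.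
by ring.
Qed.

Let int_cosk a : \int[mu]_(x in `[a - 1, a + 1]) cosk a x = 2 / k.
Proof.
have kpos := k0_gt0.
have d x : is_derive x 1 (fun y => k^-1 * sink a y) (cosk a x).
  rewrite -[cosk a x](mulKf (x := k)) ?gt_eqF//.
  exact: is_deriveZf (sink_is_derive a x).
have [_ ->] := C1_abs_cont d (@cosk_continuous a); last lra.
rewrite /sink (_ : k * (a + 1 + - a) = pi / 2) ?sin_pihalf; last by rewrite /k0; ring.
rewrite (_ : k * (a - 1 + - a) = - (pi / 2)) ?sinN ?sin_pihalf; last by rewrite /k0; ring.
by field; rewrite gt_eqF.
Qed.

Let cosk_le1 a x : `|cosk a x| <= 1. Proof. exact: cos_max. Qed.
Let sink_le1 a x : `|sink a x| <= 1. Proof. exact: sin_max. Qed.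

Let cosk_ge0 a x : a - 1 <= x <= a + 1 -> 0 <= cosk a x.
Proof.
move=> /andP[ax xa]; apply: cos_ge0_pihalf.
have kpos := k0_gt0; rewrite -[pi / 2]/(k0 R).
by apply/andP; split; nra.
Qed.

(** Integrating [resonant_test] from [x] to infinity: the boundary terms at
    infinity vanish by decay, and those at [x] are bounded by the source. *)
Lemma resonant_bound c r p g f F a x : H2rep r p g -> loc_int f ->
  {ae mu, forall x,
    c ^+ 2 * g x - discrete_laplacian r x + alpha c * r x = f x} ->
  (forall e, 0 < e -> exists X, forall x, X <= x -> `|r x| <= e /\ `|p x| <= e) ->
  (forall a b, a <= b -> \int[mu]_(x in `[a, b]) `|f x| <= F) ->
  `|c ^+ 2 * (sink a x * p x - k * (cosk a x * r x)) +
    \int[mu]_(y in `[x - 1, x + 1]) (cosk a y * r y)| <= F.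
Proof.
move=> Hr lf Hf r0 fF.
have [Q HQ HW] := resonant_test a Hr lf Hf.
set W := (fun x => _) in HW.
rewrite HQ.2; last lra.
rewrite -[X in `|X|]/(W x).
have WF T : x <= T -> `|W T - W x| <= F.
  move=> xT; rewrite -HW.2//; apply: (le_trans (le_norm_int _ _ HW.1)).
  apply: le_trans (fF _ _ xT); apply: le_int_segment.
  - by apply: loc_int_norm; case: HW.
  - exact: loc_int_norm.
  - by move=> y _; rewrite normrM ler_piMl.
have kpos := k0_gt0.
apply/ler_addgt0Pr => e e0.
(* [K] collects the coefficients of the boundary terms at [T]. *)
pose K := c ^+ 2 * (1 + k) + 2.
have K0 : 0 < K by rewrite /K; have := sqr_ge0 c; nra.
have [X HX] := r0 (e / K) (divr_gt0 e0 K0).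
pose T := Num.max x (X + 1).
have xT : x <= T by rewrite le_max lexx.
have XT : X + 1 <= T by rewrite le_max lexx orbT.
have -> : W x = W T - (W T - W x) by ring.
apply: (le_trans (ler_normB _ _)); rewrite addrC; apply: lerD; first exact: WF.
have [rT pT] : `|r T| <= e / K /\ `|p T| <= e / K by apply: HX; lra.
have E : `|Q (T + 1) - Q (T - 1)| <= e / K * 2.
  rewrite -HQ.2; last lra.
  have -> : e / K * 2 = e / K * (T + 1 - (T - 1)) by ring.
  apply: norm_int_segment_le; [lra|exact: HQ.1|].
  move=> y /andP[yT _]; rewrite normrM.
  have [ry _] : `|r y| <= e / K /\ `|p y| <= e / K by apply: HX; lra.
  by apply: le_trans ry; rewrite ler_piMl.
rewrite /W; apply: (le_trans (ler_normD _ _)).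
have eE : e = c ^+ 2 * (e / K + k * (e / K)) + e / K * 2.
  by rewrite -[LHS](divfK (lt0r_neq0 K0)) {2}/K; ring.
rewrite [leRHS]eE; apply: lerD => //.
rewrite normrM ger0_norm ?sqr_ge0//; apply: ler_wpM2l; first exact: sqr_ge0.
apply: (le_trans (ler_normB _ _)).
rewrite (normrM (sink a T)) (normrM k) (normrM (cosk a T)); apply: lerD.
  by apply: le_trans pT; rewrite ler_piMl.
rewrite (gtr0_norm kpos); apply: ler_wpM2l; first exact: ltW.
by apply: le_trans rT; rewrite ler_piMl.
Qed.

(** The constant is finite because the mass 2 / k0 of the cosine kernel is
    smaller than [c ^+ 2 * k0]: this is where the lower bound on [c ^+ 2]
    enters. *)
Lemma apriori_bound c : 83 / 100 <= c ^+ 2 -> exists2 C : R, 0 < C &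
  forall r p g f F, H2rep r p g -> loc_int f ->
  {ae mu, forall x,
    c ^+ 2 * g x - discrete_laplacian r x + alpha c * r x = f x} ->
  (exists M, forall x, `|r x| <= M) ->
  (forall e, 0 < e -> exists X, forall x, X <= x -> `|r x| <= e /\ `|p x| <= e) ->
  (forall a b, a <= b -> \int[mu]_(x in `[a, b]) `|f x| <= F) ->
  forall x, `|r x| <= C * F /\ `|p x| <= C * F.
Proof.
move=> c2; have kpos := k0_gt0.
pose d := c ^+ 2 * k - 2 / k.
have d0 : 0 < d.
  have := k0_sqr_gt R; rewrite /d => k2.
  have -> : c ^+ 2 * k - 2 / k = (c ^+ 2 * k ^+ 2 - 2) / k by field; rewrite gt_eqF.
  by apply: divr_gt0 => //; nra.
have cc : 0 < c ^+ 2 by lra.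
have ck : 0 < c ^+ 2 * k by exact: mulr_gt0.
exists (d^-1 + (c ^+ 2)^-1 * (1 + 2 / d)).
  by rewrite addr_gt0 ?invr_gt0// mulr_gt0 ?invr_gt0// addr_gt0// divr_gt0.
move=> r p g f F Hr lf Hf [M HM] r0 fF.
have F0 : 0 <= F.
  by apply: le_trans (fF 0 0 (lexx 0)); apply: int_segment_ge0 => x _.
have [dr Hp _] := Hr.
have cr := is_derive_continuous dr.
have lq a : loc_int (fun y => cosk a y * r y).
  by apply: loc_intM; [exact: cosk_continuous|exact: continuous_loc_int].
pose A := [set `|r x| | x in [set: R]].
have supA : has_sup A.
  by split; [exists `|r 0|, 0|exists M => _ [x _ <-]].
pose S := sup A.
have rS x : `|r x| <= S by apply: sup_upper_bound => //; exists x.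
have S0 : 0 <= S by exact: le_trans (rS 0).
have HS : S <= F / d.
  rewrite ler_pdivlMr//.
  suff : S <= (F + 2 / k * S) / (c ^+ 2 * k).
    by rewrite (ler_pdivlMr _ _ ck) /d mulrBr lerBlDr [S * (2 / k)]mulrC.
  apply: ge_sup; first by case: supA.
  move=> _ [x _ <-]; rewrite (ler_pdivlMr _ _ ck).
  (* With phase [x] the sine vanishes at [x], which isolates [r x]. *)
  have := resonant_bound x x Hr lf Hf r0 fF.
  rewrite {1}/sink {1}/cosk subrr mulr0 sin0 cos0 mul0r mul1r sub0r => H.
  have I1 : `|\int[mu]_(y in `[x - 1, x + 1]) (cosk x y * r y)| <= 2 / k * S.
    apply: (le_trans (le_norm_int _ _ (lq x))).
    rewrite -(int_cosk x) mulrC -int_segmentZ; last exact: continuous_loc_int.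
    apply: le_int_segment.
    - exact: loc_int_norm.
    - by apply: loc_intZ; exact: continuous_loc_int.
    - move=> y yx; rewrite normrM (ger0_norm (cosk_ge0 yx)) mulrC.
      by apply: ler_wpM2r => //; exact: cosk_ge0.
  have -> : `|r x| * (c ^+ 2 * k) = `|c ^+ 2 * (- (k * r x))|.
    rewrite (normrM (c ^+ 2)) normrN (normrM k) (gtr0_norm cc) (gtr0_norm kpos); ring.
  set I := \int[mu]_(y in _) _ in H I1.
  have -> : c ^+ 2 * (- (k * r x)) = (c ^+ 2 * (- (k * r x)) + I) - I by ring.
  by apply: (le_trans (ler_normB _ _)); apply: lerD.
have cF0 : 0 <= (c ^+ 2)^-1 * (1 + 2 / d) * F.
  apply: mulr_ge0 => //; apply: mulr_ge0; first by rewrite invr_ge0 ltW.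
  by apply: addr_ge0 => //; rewrite divr_ge0// ltW.
move=> x; split.
  apply: (le_trans (rS x)); apply: (le_trans HS).
  by rewrite mulrDl [d^-1 * F]mulrC lerDl.
(* With phase [x - 1] the cosine vanishes at [x], which isolates [p x]. *)
have := resonant_bound (x - 1) x Hr lf Hf r0 fF.
rewrite {1}/sink {1}/cosk (_ : k * (x + - (x - 1)) = pi / 2); last by rewrite /k0; ring.
rewrite sin_pihalf cos_pihalf mul0r mulr0 subr0 mul1r => H.
have I1 : `|\int[mu]_(y in `[x - 1, x + 1]) (cosk (x - 1) y * r y)| <= S * 2.
  have -> : S * 2 = S * (x + 1 - (x - 1)) by ring.
  apply: norm_int_segment_le; [lra|exact: lq|].
  by move=> y _; rewrite normrM; apply: le_trans (rS y); rewrite ler_piMl.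
set I := \int[mu]_(y in _) _ in H I1.
have : c ^+ 2 * `|p x| <= F + S * 2.
  have -> : c ^+ 2 * `|p x| = `|c ^+ 2 * p x| by rewrite (normrM (c ^+ 2)) (gtr0_norm cc).
  have -> : c ^+ 2 * p x = (c ^+ 2 * p x + I) - I by ring.
  by apply: (le_trans (ler_normB _ _)); apply: lerD.
move=> H2.
have H3 : c ^+ 2 * `|p x| <= (1 + 2 / d) * F by apply: (le_trans H2); lra.
rewrite mulrDl; apply: (@le_trans _ _ ((c ^+ 2)^-1 * (1 + 2 / d) * F)).
  by rewrite -mulrA -ler_pdivrMl ?invr_gt0// invrK.
by rewrite lerDr mulr_ge0// invr_ge0 ltW.
Qed.

End apriori.

(** * Square-integrable functions on the line *)

Section square_integrable.
Variable R : realType.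
Implicit Types (f g h u v w p q r t : R -> R) (a b x e : R) (D : set R).
Local Notation mu := (@lebesgue_measure R).
Local Notation loc_int := (locally_integrable [set: R]).
Local Notation integrableR f := (mu.-integrable [set: R] (EFin \o f)).

Lemma int_segment_le_int f a b : integrableR f -> (forall x, 0 <= f x) ->
  \int[mu]_(x in `[a, b]) f x <= \int[mu]_x f x.
Proof.
move=> fi f0; rewrite Rintegral_mkcond; apply: le_Rintegral => //.
  by rewrite -restrict_EFin; apply/integrable_restrict => //; rewrite setTI; apply: integrableS fi.
by move=> x _; rewrite patchE; case: ifPn.
Qed.

Lemma loc_int_integrable f : integrableR f -> loc_int f.
Proof. by apply: open_integrable_locally; exact: openT. Qed.

Lemma integrable_realD f g : integrableR f -> integrableR g ->
  integrableR (fun x => f x + g x).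
Proof.
by move=> i j; apply: eq_integrable (integrableD measurableT i j) => // x _.
Qed.

Lemma square_integrable_bounded u p : abs_cont u p ->
  integrableR (fun x => u x ^+ 2) -> integrableR (fun x => p x ^+ 2) ->
  exists M, forall x, `|u x| <= M.
Proof.
move=> Hu iu ip.
have lp := loc_int_integrable ip.
have iup : integrableR (fun x => u x ^+ 2 + p x ^+ 2) by exact: integrable_realD.
exists (1 + \int[mu]_x (u x ^+ 2 + p x ^+ 2) / (2 * 1)) => x.
apply: (le_trans (sobolev_sup x Hu lp ltr01)); rewrite lerD2l.
apply: ler_wpM2r; first by rewrite invr_ge0; lra.
by apply: int_segment_le_int => // y; rewrite addr_ge0 ?sqr_ge0.
Qed.

(** The bound of [sobolev_sup] for the parameter [e / 2 / 2], once the integral is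
    at most [(e / 2) ^+ 2]. *)
Lemma le_sqr_tail (I e : R) : 0 < e -> I <= (e / 2) ^+ 2 ->
  e / 2 / 2 + I / (2 * (e / 2 / 2)) <= e.
Proof.
move=> e0 Ie; have -> : 2 * (e / 2 / 2) = e / 2 by field.
have : I / (e / 2) <= e / 2 by rewrite ler_pdivrMr ?divr_gt0// -expr2.
lra.
Qed.

Lemma square_integrable_decay u p e : abs_cont u p ->
  integrableR (fun x => u x ^+ 2) -> integrableR (fun x => p x ^+ 2) -> 0 < e ->
  exists X, forall x, X <= x -> `|u x| <= e.
Proof.
move=> Hu iu ip e0.
have lp := loc_int_integrable ip.
have iup : integrableR (fun x => u x ^+ 2 + p x ^+ 2) by exact: integrable_realD.
have e2 : 0 < (e / 2) ^+ 2 by rewrite exprn_gt0// divr_gt0.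
have [X HX] := int_tail_cvg0 iup (fun x => addr_ge0 (sqr_ge0 (u x)) (sqr_ge0 (p x))) e2.
exists X => x /HX Hx.
have e4 : 0 < e / 2 / 2 by rewrite !divr_gt0.
apply: (le_trans (sobolev_sup x Hu lp e4)).
exact: le_sqr_tail.
Qed.

Lemma integrable_oneDsqrV : integrableR (fun x => (1 + x ^+ 2)^-1).
Proof.
have c : continuous (fun x : R => (1 + x ^+ 2)^-1) by exact: continuous_oneDsqrV.
have ge0 x : 0 <= (1 + x ^+ 2)^-1 by rewrite invr_ge0 addr_ge0// sqr_ge0.
apply/integrableP; split.
  by apply/measurable_EFinP; exact: continuous_measurable_fun.
have -> : (\int[mu]_x `|((1 + x ^+ 2)^-1)%:E|)%E = (\int[mu]_x ((1 + x ^+ 2)^-1)%:E)%E.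
  by apply: eq_integral => x _; rewrite gee0_abs// lee_fin.
rewrite (ge0_symfun_integralT ge0 c); last by move=> x /=; rewrite sqrrN.
rewrite -set_itvcy; have := integral0y_oneDsqr R; rewrite /oneDsqr => ->.
by rewrite -EFinM ltry.
Qed.

Let D1 : set R := ~` `[-1, 1].

Lemma integrable_outside_segment f : loc_int f -> (forall x, 0 <= f x) ->
  (\int[mu]_(x in D1) (f x)%:E < +oo)%E -> integrableR f.
Proof.
move=> [mf oT Hf] f0 H; apply/integrableP; split; first exact/measurable_EFinP.
have -> : (\int[mu]_x `|(f x)%:E| = \int[mu]_(x in `[(-1)%R, 1%R] `|` D1) (f x)%:E)%E.
  by rewrite /D1 setUv; apply: eq_integral => x _; rewrite gee0_abs// lee_fin.
rewrite ge0_integral_setU//=.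
- apply: lte_add_pinfty => //.
  have := Hf `[-1, 1]%classic (@subsetT _ _) (@segment_compact _ _ _).
  apply: le_lt_trans; rewrite le_eqVlt; apply/orP; left; apply/eqP.
  by apply: eq_integral => x _; rewrite ger0_norm.
- exact: measurableC.
- by apply/measurable_EFinP; exact: measurable_funTS.
- by move=> x _; rewrite lee_fin.
- by rewrite /D1 disj_set2E setICr.
Qed.

(** The weight turns square integrability into integrability, by Young's
    inequality against the integrable function [(1 + x ^+ 2)^-1]. *)
Lemma weighted_integrable t w : loc_int t -> loc_int (fun x => t x ^+ 2) ->
  L2 D1 (fun x => (1 + x ^+ 2) * w x) ->
  {ae mu, forall x, D1 x -> w x = t x} ->
  integrableR (fun x => `|t x|) /\ integrableR (fun x => t x ^+ 2).
Proof.
move=> lt lt2 [mw Hw] wt; have [mt _ _] := lt.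
have mD : measurable D1 by exact: measurableC.
have mp : measurable_fun D1 (fun x : R => 1 + x ^+ 2).
  by apply: measurable_funTS; apply: measurable_funD => //; exact: measurable_funX.
have mt2 : measurable_fun D1 (fun x => ((1 + x ^+ 2) * t x) ^+ 2).
  by apply: measurable_funX; apply: measurable_funM => //; exact: measurable_funTS.
have Ht : (\int[mu]_(x in D1) (((1 + x ^+ 2) * t x) ^+ 2)%:E < +oo)%E.
  apply: le_lt_trans Hw; rewrite le_eqVlt; apply/orP; left; apply/eqP.
  apply: ae_eq_integral => //.
  - exact/measurable_EFinP.
  - by apply/measurable_EFinP; exact: measurable_funX.
  - by apply: ae_imply wt => x H Dx; rewrite H.
have mV : measurable_fun D1 (fun x : R => (1 + x ^+ 2)^-1).
  by apply: measurable_funTS; apply: continuous_measurable_fun; exact: continuous_oneDsqrV.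
split; apply: integrable_outside_segment => //.
- exact: loc_int_norm.
- pose F x := ((1 + x ^+ 2) * t x) ^+ 2 + (1 + x ^+ 2)^-1.
  apply: (@le_lt_trans _ _ (integral mu D1 (EFin \o F))).
    apply: ge0_le_integral => //.
    + by apply/measurable_EFinP/measurableT_comp => //; exact: measurable_funTS.
    + by apply/measurable_EFinP; exact: measurable_funD.
    + move=> x _; rewrite lee_fin /F.
      set y := 1 + x ^+ 2.
      have y0 : 0 < y by rewrite /y; have := sqr_ge0 x; lra.
      rewrite -(ler_pM2r y0) mulrDl mulVf ?gt_eqF//.
      have y1 : 1 <= y by rewrite /y; have := sqr_ge0 x; lra.
      have -> : (y * t x) ^+ 2 = (y * `|t x|) ^+ 2.
        by rewrite !exprMn real_normK// num_real.
      move: (normr_ge0 (t x)); set A := `|t x| => A0.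
      rewrite [leLHS]mulrC; move: (y * A) => z.
      have : 0 <= (y - 1) * z ^+ 2 by rewrite mulr_ge0 ?sqr_ge0// subr_ge0.
      by have := sqr_ge0 (z - 1 / 2); lra.
  under eq_integral do rewrite /= EFinD.
  rewrite ge0_integralD//.
  + apply: lte_add_pinfty => //.
    have /integrableP[_] := integrable_oneDsqrV.
    apply: le_lt_trans.
    apply: (@le_trans _ _ (integral mu D1 (fun x => `|((1 + x ^+ 2)^-1)%:E|%E))).
      apply: ge0_le_integral => //.
      * by move=> x _; rewrite lee_fin invr_ge0 addr_ge0// sqr_ge0.
      * exact/measurable_EFinP.
      * by apply: measurableT_comp => //; exact/measurable_EFinP.
      * by move=> x _; exact: lee_abs.
    apply: ge0_subset_integral => //.
    apply: measurableT_comp => //; apply/measurable_EFinP.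
    by apply: continuous_measurable_fun; exact: continuous_oneDsqrV.
  + by move=> x _; rewrite lee_fin sqr_ge0.
  + exact/measurable_EFinP.
  + by move=> x _; rewrite lee_fin invr_ge0 addr_ge0// sqr_ge0.
  + exact/measurable_EFinP.
- by move=> x; exact: sqr_ge0.
- apply: le_lt_trans Ht; apply: ge0_le_integral => //.
  + by move=> x _; rewrite lee_fin sqr_ge0.
  + by apply/measurable_EFinP; apply: measurable_funX; exact: measurable_funTS.
  + exact/measurable_EFinP.
  + move=> x _; rewrite lee_fin exprMn ler_peMl ?sqr_ge0//.
    by have := sqr_ge0 x; nra.
Qed.

End square_integrable.

(** * The single transition wave *)

Section single_transition.
Variable R : realType.
Implicit Types (f g h u v w p q r us lam : R -> R) (a b c x y e : R) (D : set R).
Local Notation mu := (@lebesgue_measure R).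
Local Notation loc_int := (locally_integrable [set: R]).
Local Notation k := (k0 R).

Lemma transition_derivatives lam : transition_function lam ->
  exists l1 l2 : R -> R, exists2 M, 0 <= M &
  [/\ forall x, is_derive x 1 lam (l1 x), forall x, is_derive x 1 l1 (l2 x),
      continuous l2,
      forall x, 1 < `|x| -> l1 x = 0 /\ l2 x = 0 &
      forall x, `|l1 x| <= M /\ `|l2 x| <= M].
Proof.
move=> [slam olam mlam lamN lamP].
pose l1 := derive1 lam; pose l2 := derive1 l1.
have d0 x : is_derive x 1 lam (l1 x).
  by rewrite /l1 derive1E; split => //; exact: (slam 0 x).
have d1 x : is_derive x 1 l1 (l2 x).
  by rewrite /l2 derive1E; split => //; exact: (slam 1 x).
have d2 x : is_derive x 1 l2 (derive1 l2 x).
  by rewrite [derive1 l2 x]derive1E; split => //; exact: (slam 2 x).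
have c2 := is_derive_continuous d2; have c1 := is_derive_continuous d1.
have z1 x : 1 < `|x| -> l1 x = 0.
  move=> x1; rewrite /l1 derive1E (@near_eq_derive _ _ _ _ (fun=> lam x)) ?derive_cst//.
  near=> y.
  have : `|y - x| < `|x| - 1 by near: y; apply: near_dist; rewrite subr_gt0.
  have [x0|x0] := leP 0 x.
    have := x1; rewrite (ger0_norm x0) ltr_norml => x2 yx.
    by rewrite !lamP//; lra.
  have := x1; rewrite (ltr0_norm x0) ltr_norml => x2 yx.
  by rewrite !lamN//; lra.
have z2 x : 1 < `|x| -> l2 x = 0.
  move=> x1; rewrite /l2 derive1E (@near_eq_derive _ _ _ _ (fun=> 0)) ?derive_cst//.
  near=> y; apply: z1.
  have : `|y - x| < `|x| - 1 by near: y; apply: near_dist; rewrite subr_gt0.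
  by have := ler_dist_dist x y; rewrite (distrC x y); have := ler_norm (`|x| - `|y|); lra.
have [M1 M10 HM1] := continuous_segment_bounded (-1) 1 c1.
have [M2 M20 HM2] := continuous_segment_bounded (-1) 1 c2.
exists l1, l2, (Num.max M1 M2); first by rewrite le_max ltW.
split => // x; first by move=> x1; rewrite z1 ?z2.
have [x1|x1] := ltP 1 `|x|.
  by rewrite z1// z2// normr0 le_max ltW.
rewrite ler_norml in x1; rewrite !le_max.
by split; apply/orP; [left; exact: HM1|right; exact: HM2].
Unshelve. all: by end_near. Qed.

Lemma transition_bound lam x : transition_function lam -> -(1/2) <= lam x <= 1 / 2.
Proof.
move=> [slam olam mlam lamN lamP].
have [x1|x1] := leP x (-1); first by rewrite lamN//; lra.
have [x2|x2] := leP 1 x; first by rewrite lamP//; lra.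
by rewrite -(lamN (-1)) ?lexx// -(lamP 1) ?lexx// !mlam// ltW.
Qed.

(** The profile [Num.sg x * h x] jumps at the origin; [2 * lam x * h x] is a
    smooth function that agrees with it away from the origin. *)
Lemma transition_sg lam x : transition_function lam -> 1 <= `|x| ->
  2 * lam x = Num.sg x.
Proof.
move=> [slam olam mlam lamN lamP].
have [x0|x0] := leP 0 x; rewrite ?(ger0_norm x0) ?(ltr0_norm x0) => x1.
  by rewrite lamP// gtr0_sg; lra.
by rewrite lamN ?ltr0_sg//; lra.
Qed.

Lemma limf_einf_gt0 (F : set_system R) f : Filter F ->
  (0 < limf_einf (fun x => (f x)%:E) F)%E ->
  exists2 m : R, 0 < m & F [set x | m <= f x].
Proof.
move=> FF; rewrite limf_einfE => /ereal_sup_gt[_ [V FV <-] V0].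
have [m m0 mV] : exists2 m : R, 0 < m &
    (m%:E <= ereal_inf [set (f x)%:E | x in V])%E.
  move: V0; case: ereal_inf => [r r0||] //=; first by exists r.
  by move=> _; exists 1 => //; rewrite leey.
exists m => //; apply: filterS FV => x Vx /=.
by rewrite -lee_fin; move/ereal_infP: mV; apply; exists x.
Qed.

(** The limit inferior controls the wave at infinity, compactness and the sign
    condition control it in between. *)
Lemma single_transition_away c us d : single_transition c us -> 0 < d ->
  exists2 m : R, 0 < m & forall x, d <= `|x| -> m <= `|us x|.
Proof.
move=> [[ous [Hus _] sus] [_ [Hp _] _]] d0.
have cus : continuous us by case: Hus.
have pos x : 0 < x -> 0 < us x.
  by move=> x0; rewrite -sgr_cp0 sus gtr0_sg.
have [m1 m10 [X [_ HX]]] := limf_einf_gt0 _ Hp.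
pose Z := Num.max d (X + 1).
have [y] := @EVT_min R us d Z ltac:(by rewrite le_max lexx) (continuous_subspaceT cus).
rewrite in_itv /= => /andP[dy yZ] Hy.
have uy : 0 < us y by apply: pos; exact: lt_le_trans dy.
have H x : d <= x -> Num.min m1 (us y) <= us x.
  move=> dx; have x0 : 0 < x by exact: lt_le_trans dx.
  rewrite ge_min; have [xZ|Zx] := leP x Z.
    by rewrite Hy ?orbT// in_itv /= dx.
  rewrite -(gtr0_norm (pos x x0)) HX//.
  by apply: lt_trans Zx; rewrite lt_max; apply/orP; right; lra.
exists (Num.min m1 (us y)); first by rewrite lt_min m10.
move=> x; have [x0|x0] := leP 0 x.
  by rewrite (ger0_norm x0) => /H; move=> /le_trans; apply; exact: ler_norm.
rewrite (ltr0_norm x0) => /H; rewrite ous => /le_trans; apply.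
by rewrite -normrN ler_norm.
Qed.

Lemma is_derive_cos_k0 x : is_derive x 1 (fun y => cos (k * y)) (k * - sin (k * x)).
Proof.
have := @is_derive_comp_affine _ cos k 0 x (- sin (k * x)).
by rewrite addr0; under eq_fun do rewrite addr0; apply.
Qed.

Lemma is_derive_sin_k0 x : is_derive x 1 (fun y => sin (k * y)) (k * cos (k * x)).
Proof.
have := @is_derive_comp_affine _ sin k 0 x (cos (k * x)).
by rewrite addr0; under eq_fun do rewrite addr0; apply.
Qed.

Lemma H2rep_cos_k0 : H2rep (fun x => cos (k * x)) (fun x => k * - sin (k * x))
  (fun x => k * - (k * cos (k * x))).
Proof.
have cc := is_derive_continuous is_derive_cos_k0.
have dN x : is_derive x 1 (fun y => - sin (k * y)) (- (k * cos (k * x))).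
  have := is_deriveZf (-1) (is_derive_sin_k0 x); rewrite mulN1r.
  by under eq_fun do rewrite mulN1r.
apply: (C2_H2rep is_derive_cos_k0 (fun x => is_deriveZf k (dN x))) => x.
apply: cvgM; first exact: cvg_cst.
by apply: cvgN; apply: cvgM; [exact: cvg_cst|exact: cc].
Qed.

Lemma H2rep_sin_k0 : H2rep (fun x => sin (k * x)) (fun x => k * cos (k * x))
  (fun x => k * (k * - sin (k * x))).
Proof.
have cs := is_derive_continuous is_derive_sin_k0.
apply: (C2_H2rep is_derive_sin_k0 (fun x => is_deriveZf k (is_derive_cos_k0 x))) => x.
apply: cvgM; first exact: cvg_cst.
by apply: cvgM; [exact: cvg_cst|apply: cvgN; exact: cs].
Qed.

Lemma H2rep_cst a : H2rep (fun=> a) (fun=> 0) (fun=> 0).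
Proof.
apply: C2_H2rep; last exact: cst_continuous.
all: by move=> x; exact: is_derive_cst.
Qed.

(** In the norm, the chosen weak derivatives may be replaced by the derivatives of
    a regular extension. *)
Lemma H2norm_le D (u v p g : R -> R) e : open D -> H2rep u p g ->
  (forall x, D x -> v x = u x) -> 0 <= e -> (H2norm D v <= e%:E)%E ->
  (\int[mu]_(x in D) (u x ^+ 2 + p x ^+ 2 + g x ^+ 2)%:E <= (e ^+ 2)%:E)%E.
Proof.
move=> oD Hu vu e0; rewrite /H2norm.
have mD := open_measurable oD.
have [wu wp e1 e2] := H2rep_wderivn oD Hu vu.
have [_ [m1 _ _] _] := wderivP wu.
have [_ [m2 _ _] _] := wderivP wp.
have [du [[mg _ _] Hp] _] := Hu.
have mu' : measurable_fun D u.
  by apply: measurable_funTS; apply: continuous_measurable_fun; exact: is_derive_continuous du.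
have mp : measurable_fun D p.
  apply: measurable_funTS; apply: continuous_measurable_fun.
  by apply: (@abs_cont_continuous _ _ g); case: Hu.
have mg' : measurable_fun D g by exact: measurable_funTS.
have mv : measurable_fun D v by apply: eq_measurable_fun mu' => x; rewrite inE => /vu.
have -> : (\int[mu]_(x in D) (\sum_(l < 3) (wderivn D l v x) ^+ 2)%:E =
  \int[mu]_(x in D) (u x ^+ 2 + p x ^+ 2 + g x ^+ 2)%:E)%E.
  apply: ae_eq_integral => //.
  - apply/measurable_EFinP; under eq_fun do rewrite !big_ord_recl big_ord0 addr0.
    by apply: measurable_funD; [|apply: measurable_funD]; exact: measurable_funX.
  - apply/measurable_EFinP.
    by apply: measurable_funD; [apply: measurable_funD|]; exact: measurable_funX.
  - apply: ae_imply2 e1 e2 => x H1 H2 Dx.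
    by rewrite !big_ord_recl big_ord0 addr0 addrA -(H1 Dx) -(H2 Dx) -(vu _ Dx).
set I := integral _ _ _ => H.
have I0 : (0 <= I)%E.
  by apply: integral_ge0 => x _; rewrite lee_fin !addr_ge0 ?sqr_ge0.
rewrite -(sqr_sqrte I0) EFin_expe !expe2; apply: lee_pmul => //; exact: sqrte_ge0.
Qed.

Lemma cvg0_near_le (F : set_system R) (f : R -> \bar R) e : 0 < e ->
  f z @[z --> F] --> 0%E -> F [set z | (f z <= e%:E)%E].
Proof.
move=> e0 H.
have N : nbhs (0 : \bar R)%E [set y : \bar R | (y <= e%:E)%E].
  apply: (@filterS _ _ _ [set y : \bar R | (y < e%:E)%E]); first by move=> y /ltW.
  by apply: open_nbhs_nbhs; split; [exact: open_ereal_lt_ereal|rewrite /= lte_fin].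
exact: (H _ N).
Qed.

(** Away from the transition the wave is [C^1]-close to the periodic profile. *)
Lemma single_transition_asymptotics c us lam up ug :
  single_transition c us -> transition_function lam -> H2rep us up ug ->
  exists w p g, [/\ H2rep w p g,
    forall x, 1 <= `|x| -> w x = us x - asymptotic_profile c x &
    forall e, 0 < e -> exists2 Z, 0 < Z & forall x, Z <= `|x| ->
      `|w x| <= e /\ `|p x| <= e].
Proof.
move=> [_ [_ _ [Wp Wn]]] tl Hus.
have [l1 [l2 [M M0 [dl dl1 cl2 _ _]]]] := transition_derivatives tl.
have Hprof := H2repZ 2 (H2repM dl dl1 cl2 
  (H2repB (H2rep_cst 1) (H2repZ (asymptotic_amplitude c) H2rep_cos_k0))).
have Hw := H2repB Hus Hprof.
set w := (fun x => _) in Hw; set p := (fun x => _) in Hw; set g := (fun x => _) in Hw.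
have wE x : 1 <= `|x| -> w x = us x - asymptotic_profile c x.
  by move=> x1; rewrite /w /asymptotic_profile -(transition_sg tl x1) mulrA.
clearbody w p g.
exists w, p, g; split => // e e0.
have e4 : 0 < e / 2 by rewrite divr_gt0.
have [Z1 [_ HZ1]] := cvg0_near_le e4 Wp.
have [Z2 [_ HZ2]] := cvg0_near_le e4 Wn.
(* The summand 4 keeps the window of half-width 2 off the unit interval. *)
pose Z := `|Z1| + `|Z2| + 4.
exists Z; first by rewrite /Z; have := normr_ge0 Z1; have := normr_ge0 Z2; lra.
move=> x Zx.
have x4 : 4 <= `|x|.
  by apply: le_trans Zx; rewrite /Z; have := normr_ge0 Z1; have := normr_ge0 Z2; lra.
have Wx : (H2_window_error c us x <= (e / 2)%:E)%E.
  have [x0|x0] := leP 0 x.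
    apply: HZ1; move: Zx; rewrite (ger0_norm x0) /Z.
    by have := ler_norm Z1; have := normr_ge0 Z2; lra.
  apply: HZ2; move: Zx; rewrite (ltr0_norm x0) /Z.
  by have := ler_norm (- Z2); rewrite normrN; have := normr_ge0 Z1; lra.
have oD : open `]x - 2, x + 2[%classic by exact: interval_open.
have := H2norm_le oD Hw _ (ltW e4) Wx.
have wD y : `]x - 2, x + 2[%classic y -> us y - asymptotic_profile c y = w y.
  rewrite /= in_itv /= => yx; rewrite wE//.
  have : `|y - x| <= 2 by rewrite ler_norml; lra.
  by have := ler_norm (`|x| - `|y|); have := ler_dist_dist x y; rewrite (distrC x y); lra.
move=> /(_ wD) I.
have [dw Hp lg2] := Hw.
have cp := abs_cont_continuous Hp; have cw := is_derive_continuous dw.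
have lw2 := continuous_sqr_loc_int cw; have lp2 := continuous_sqr_loc_int cp.
have [lg _] := Hp; have [mg _ _] := lg.
have bound q : loc_int q -> (forall y, 0 <= q y <= w y ^+ 2 + p y ^+ 2 + g y ^+ 2) ->
    \int[mu]_(y in `[x, x + 1]) q y <= (e / 2) ^+ 2.
  move=> lq Hq; have [mq _ _] := lq.
  rewrite -lee_fin /Rintegral fineK; last first.
    exact/integrable_fin_num/(loc_int_segment _ _ lq).
  apply: le_trans I.
  apply: (@le_trans _ _ (integral mu `]x - 2, x + 2[ (EFin \o q))).
    apply: ge0_subset_integral => //.
    - by apply/measurable_EFinP; exact: measurable_funTS.
    - by move=> y _; rewrite lee_fin; case/andP: (Hq y).
    - by move=> y; rewrite /= !in_itv /=; lra.
  apply: ge0_le_integral => //.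
  - by move=> y _; rewrite lee_fin; case/andP: (Hq y).
  - by apply/measurable_EFinP; exact: measurable_funTS.
  - apply/measurable_EFinP; apply: measurable_funTS.
    apply: measurable_funD; [apply: measurable_funD|]; apply: measurable_funX => //.
      exact: continuous_measurable_fun.
    exact: continuous_measurable_fun.
  - by move=> y _; rewrite lee_fin; case/andP: (Hq y).
have sob u q : abs_cont u q -> loc_int (fun y => q y ^+ 2) ->
    (forall y, u y ^+ 2 + q y ^+ 2 <= w y ^+ 2 + p y ^+ 2 + g y ^+ 2) -> `|u x| <= e.
  move=> Huq lq2 Hq.
  have e8 : 0 < e / 2 / 2 by rewrite divr_gt0.
  apply: (le_trans (sobolev_sup x Huq lq2 e8)).
  suff Hi : \int[mu]_(y in `[x, x + 1]) (u y ^+ 2 + q y ^+ 2) <= (e / 2) ^+ 2.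
    exact: le_sqr_tail.
  apply: bound => [|y]; last by rewrite Hq addr_ge0 ?sqr_ge0.
  apply: locally_integrableD => //; apply: continuous_sqr_loc_int.
  exact: abs_cont_continuous Huq.
split.
- apply: (sob _ _ (C1_abs_cont dw cp) lp2) => y.
  by rewrite lerDl sqr_ge0.
- apply: (sob _ _ Hp lg2) => y.
  by rewrite lerD2r lerDr sqr_ge0.
Qed.

End single_transition.

(** * The glued wave *)

(** The residual of the glued wave, a commutator of [L] with the cut-off [lam].
    It only involves the sum [s] of the two translates of the single transition
    wave and the derivative [s1] of this sum; [l1] and [l2] are the derivatives
    of [lam]. *)
Definition gluing_defect (R : realType) (c : R) (lam l1 l2 s s1 : R -> R) (x : R) : R :=
  - c ^+ 2 * (l2 x * s x + 2 * l1 x * s1 x)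
  + (lam (x + 1) - lam x) * s (x + 1) + (lam (x - 1) - lam x) * s (x - 1).

Section glued_wave.
Variable R : realType.
Implicit Types (f g h u v w p q r us up ug lam : R -> R) (a b c x y e : R) (D : set R).
Local Notation mu := (@lebesgue_measure R).
Local Notation loc_int := (locally_integrable [set: R]).
Local Notation k := (k0 R).

Lemma even_integer_phase (x0 : R) : (exists m : int, x0 = 2 * m%:~R) ->
  sin (k * x0) = 0 /\ `|cos (k * x0)| = 1.
Proof.
move=> [m ->].
have H (n : nat) : sin (pi * n%:R) = 0 :> R.
  elim: n => [|n IH]; first by rewrite mulr0 sin0.
  by rewrite -addn1 natrD mulrDr mulr1 sinDpi IH oppr0.
have E : k * (2 * m%:~R) = pi * m%:~R by rewrite /k0; field.
have S : sin (k * (2 * m%:~R)) = 0.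
  rewrite E; case: m {E} => n; first exact: H.
  by rewrite NegzE mulrNz mulrN sinN H oppr0.
by split => //; exact: sin0cos1.
Qed.

Lemma vp_even lam us x0 : odd_fun lam -> odd_fun us -> even_fun (vp lam us x0).
Proof.
move=> ol ou x; rewrite /vp ol.
have -> : - x - x0 = - (x + x0) by ring.
have -> : - x + x0 = - (x - x0) by ring.
by rewrite !ou; ring.
Qed.

Lemma vp_right lam us x0 x : transition_function lam -> 1 <= x ->
  vp lam us x0 x = us (x - x0).
Proof. by move=> [_ _ _ _ lamP] x1; rewrite /vp lamP//; field. Qed.

Lemma vp_left lam us x0 x : transition_function lam -> x <= -1 ->
  vp lam us x0 x = - us (x + x0).
Proof. by move=> [_ _ _ lamN _] x1; rewrite /vp lamN//; field. Qed.

(** Between the transitions the glued wave is a convex combination of two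
    negative values. *)
Lemma vp_middle lam us x0 m x : transition_function lam ->
  us (x - x0) <= - m -> m <= us (x + x0) ->
  vp lam us x0 x <= - m.
Proof.
move=> tl H1 H2; have /andP[l1 l2] := transition_bound x tl.
rewrite /vp; have h1 : 0 <= (1 / 2 + lam x) * (- m - us (x - x0)) by apply: mulr_ge0; lra.
have h2 : 0 <= (1 / 2 - lam x) * (us (x + x0) - m) by apply: mulr_ge0; lra.
lra.
Qed.

(** On [-1, 1] both translates have constant signs and the glued wave is negative;
    elsewhere it is one of the two translates. *)
Lemma vp_sg c lam us x0 x : single_transition c us -> transition_function lam ->
  1 < x0 -> Num.sg (vp lam us x0 x) =
    (1 / 2 + lam x) * Num.sg (x - x0) - (1 / 2 - lam x) * Num.sg (x + x0).
Proof.
move=> [[ous _ sus] _] tl x01; have [_ _ _ lamN lamP] := tl.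
have [x1|x1] := leP 1 x; first by rewrite vp_right// sus lamP//; field.
have [x2|x2] := leP x (-1).
  by rewrite vp_left// sgrN sus lamN//; field.
have /andP[h1 h2] := transition_bound x tl.
have s1 : Num.sg (us (x - x0)) = -1 by rewrite sus ltr0_sg//; lra.
have s2 : Num.sg (us (x + x0)) = 1 by rewrite sus gtr0_sg//; lra.
rewrite -(sus (x - x0)) -(sus (x + x0)) s1 s2 ltr0_sg; first by field.
have {}s1 : us (x - x0) < 0 by rewrite -sgr_cp0 s1.
have {}s2 : 0 < us (x + x0) by rewrite -sgr_cp0 s2.
rewrite /vp; nra.
Qed.

Lemma vp_H2rep lam l1 l2 us up ug x0 :
  (forall x : R, is_derive x 1 lam (l1 x)) -> (forall x : R, is_derive x 1 l1 (l2 x)) ->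
  continuous l2 -> H2rep us up ug ->
  exists q, H2rep (vp lam us x0) q (fun x =>
    l2 x * us (x - x0) + 2 * l1 x * up (x - x0) + (1 / 2 + lam x) * ug (x - x0) -
    (- l2 x * us (x + x0) + 2 * - l1 x * up (x + x0) + (1 / 2 - lam x) * ug (x + x0))).
Proof.
move=> d0 d1 c2 Hus.
have dp x : is_derive x 1 (fun y => 1 / 2 + lam y) (l1 x).
  by rewrite -[l1 x]add0r; apply: (is_deriveDf (is_derive_cst _ _ _) (d0 x)).
have dm x : is_derive x 1 (fun y => 1 / 2 - lam y) (- l1 x).
  by rewrite -[- l1 x]add0r; apply: (is_deriveBf (is_derive_cst _ _ _) (d0 x)).
have dm1 x : is_derive x 1 (fun y => - l1 y) (- l2 x).
  have := is_deriveZf (-1) (d1 x); rewrite mulN1r.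
  by under eq_fun do rewrite mulN1r.
have cm2 : continuous (fun y => - l2 y) by move=> x; apply: cvgN; exact: c2.
have Ha := H2repM dp d1 c2 (H2rep_translate (- x0) Hus).
have Hb := H2repM dm dm1 cm2 (H2rep_translate x0 Hus).
by eexists; exact: H2repB Ha Hb.
Qed.

(** Both translates solve the equation with their own sign, and the signs
    recombine to the sign of the glued wave: only the commutators with the
    cut-off remain. *)
Lemma vp_defect c lam l1 l2 us up ug x0 : single_transition c us ->
  transition_function lam ->
  (forall x : R, is_derive x 1 lam (l1 x)) -> (forall x : R, is_derive x 1 l1 (l2 x)) ->
  continuous l2 -> H2rep us up ug -> ug = wderivn [set: R] 2 us -> 1 < x0 ->
  {ae mu, forall x, - L c (vp lam us x0) x + alpha c * Num.sg (vp lam us x0 x) =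
    gluing_defect c lam l1 l2 (fun y => us (y - x0) + us (y + x0))
      (fun y => up (y - x0) + up (y + x0)) x}.
Proof.
move=> ST tl d0 d1 c2 Hus ugE x01.
have [[ous [_ sol] sus] _] := ST.
have [q Hq] := vp_H2rep x0 d0 d1 c2 Hus.
have [_ e2] := H2rep_H2loc Hq.
have em := ae_translate (- x0) sol; have ep := ae_translate x0 sol.
move: e2 em ep; apply: ae_imply3 => x e2 em ep.
rewrite (vp_sg x ST tl x01) {1}/L e2 /gluing_defect.
move: em ep; rewrite /L -ugE !sus /discrete_laplacian /vp.
have -> : x + 1 - x0 = x - x0 + 1 by ring.
have -> : x - 1 - x0 = x - x0 - 1 by ring.
have -> : x + 1 + x0 = x + x0 + 1 by ring.
have -> : x - 1 + x0 = x + x0 - 1 by ring.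
move=> em ep.
have {}em : c ^+ 2 * ug (x - x0) = us (x - x0 + 1) - 2 * us (x - x0) + us (x - x0 - 1)
   - alpha c * us (x - x0) + alpha c * Num.sg (x - x0) by lra.
have {}ep : c ^+ 2 * ug (x + x0) = us (x + x0 + 1) - 2 * us (x + x0) + us (x + x0 - 1)
   - alpha c * us (x + x0) + alpha c * Num.sg (x + x0) by lra.
set A := (1 / 2 + lam x); set B := (1 / 2 - lam x).
have -> : forall X Y Z : R,
   - (c ^+ 2 * (l2 x * us (x - x0) + 2 * l1 x * up (x - x0) + A * ug (x - x0) -
     (- l2 x * us (x + x0) + 2 * - l1 x * up (x + x0) + B * ug (x + x0))) - X + Y) + Z =
   - c ^+ 2 * (l2 x * (us (x - x0) + us (x + x0)) + 2 * l1 x * (up (x - x0) + up (x + x0)))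
   - A * (c ^+ 2 * ug (x - x0)) + B * (c ^+ 2 * ug (x + x0)) + X - Y + Z.
  by move=> X Y Z; ring.
by rewrite em ep /A /B; ring.
Qed.

Lemma gluing_defect_continuous c lam l1 l2 s s1 : continuous lam -> continuous l1 ->
  continuous l2 -> continuous s -> continuous s1 ->
  continuous (gluing_defect c lam l1 l2 s s1).
Proof.
move=> cl c1 c2 cs cs1.
have C (a : R) : continuous (fun _ : R => a) by exact: cst_continuous.
rewrite /gluing_defect.
apply: continuousDf; first apply: continuousDf.
- apply: continuousMf; first exact: C.
  apply: continuousDf; first exact: continuousMf.
  by apply: continuousMf => //; exact: continuousMf.
- apply: continuousMf; last exact: continuous_translate.
  by apply: continuousBf => //; exact: continuous_translate.
- apply: continuousMf; last exact: continuous_translate.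
  by apply: continuousBf => //; exact: continuous_translate.
Qed.

Lemma gluing_defect_bound c lam l1 l2 s s1 M e x : transition_function lam ->
  (forall x, 1 < `|x| -> l1 x = 0 /\ l2 x = 0) ->
  (forall x, `|l1 x| <= M /\ `|l2 x| <= M) ->
  (forall y, `|y| <= 3 -> `|s y| <= e /\ `|s1 y| <= e) ->
  `|gluing_defect c lam l1 l2 s s1 x| <= (c ^+ 2 * (3 * M) + 2) * e /\
  (2 <= `|x| -> gluing_defect c lam l1 l2 s s1 x = 0).
Proof.
move=> tl l0 lM ss; have [_ _ _ lamN lamP] := tl.
have z : 2 <= `|x| -> gluing_defect c lam l1 l2 s s1 x = 0.
  move=> x2; rewrite /gluing_defect; have [|-> ->] := l0 x; first lra.
  have [x0|x0] := leP 0 x; rewrite ?(ger0_norm x0) ?(ltr0_norm x0) in x2.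
    by rewrite !lamP; [ring|lra..].
  by rewrite !lamN; [ring|lra..].
split => //.
have M0 : 0 <= M by have [h _] := lM 0; exact: le_trans h.
have e0 : 0 <= e by have [|h _] := ss 0; rewrite ?normr0//; exact: le_trans h.
have [x2|x2] := leP 2 `|x|.
  by rewrite z// normr0 mulr_ge0// addr_ge0// mulr_ge0 ?sqr_ge0// mulr_ge0.
have [sx s1x] : `|s x| <= e /\ `|s1 x| <= e by apply: ss; lra.
have [sp _] : `|s (x + 1)| <= e /\ `|s1 (x + 1)| <= e.
  by apply: ss; apply: (le_trans (ler_normD _ _)); rewrite normr1; lra.
have [sm _] : `|s (x - 1)| <= e /\ `|s1 (x - 1)| <= e.
  by apply: ss; apply: (le_trans (ler_normB _ _)); rewrite normr1; lra.
have [l1x l2x] := lM x.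
have T (d t : R) : `|d| <= t -> 0 <= t -> forall y a, `|y| <= a -> `|d * y| <= t * a.
  by move=> ht t0 y a ya; rewrite normrM; apply: ler_pM.
have lD y z' : `|lam y - lam z'| <= 1.
  have := transition_bound y tl; have := transition_bound z' tl.
  by rewrite ler_norml; lra.
rewrite /gluing_defect.
have -> : (c ^+ 2 * (3 * M) + 2) * e = c ^+ 2 * (M * e + (2 * M) * e) + 1 * e + 1 * e by ring.
apply: (le_trans (ler_normD _ _)); apply: lerD; last exact: T.
apply: (le_trans (ler_normD _ _)); apply: lerD; last exact: T.
apply: (T).
- by rewrite normrN ger0_norm// sqr_ge0.
- exact: sqr_ge0.
apply: (le_trans (ler_normD _ _)); apply: lerD; first exact: T.
apply: (T) => //; last by rewrite mulr_ge0.
by rewrite normrM ger0_norm// ler_wpM2l.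
Qed.

(** The periodic tails of the two translates cancel because [x0] is an even
    integer, hence a multiple of half their period. *)
Lemma translates_cancel c us lam up ug : single_transition c us ->
  transition_function lam -> H2rep us up ug -> forall e, 0 < e ->
  exists2 Z, 0 < Z & forall x0, (exists m : int, x0 = 2 * m%:~R) -> Z <= x0 ->
  forall x, `|x| <= 3 -> `|us (x - x0) + us (x + x0)| <= e /\
                         `|up (x - x0) + up (x + x0)| <= e.
Proof.
move=> ST tl Hus e e0.
have [w [p [g [Hw wE Hs]]]] := single_transition_asymptotics ST tl Hus.
have [Z Z0 HZ] := Hs (e / 2) ltac:(by rewrite divr_gt0).
exists (Z + 5); first lra.
move=> x0 /even_integer_phase[sx0 _] Zx0 x x3.
have sE y : `|y| < 4 -> us (y - x0) + us (y + x0) = w (y - x0) + w (y + x0).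
  rewrite ltr_norml => y4.
  rewrite !wE; last 2 first.
  - by rewrite ger0_norm; lra.
  - by rewrite ler0_norm; lra.
  rewrite /asymptotic_profile ltr0_sg; last lra.
  rewrite gtr0_sg; last lra.
  by rewrite (mulrBr k) (mulrDr k) cosB cosD sx0; ring.
have {}x3 : `|x| < 4 by lra.
have x4 := x3; rewrite ltr_norml in x4.
have [w1 p1] : `|w (x - x0)| <= e / 2 /\ `|p (x - x0)| <= e / 2.
  by apply: HZ; rewrite ler0_norm; lra.
have [w2 p2] : `|w (x + x0)| <= e / 2 /\ `|p (x + x0)| <= e / 2.
  by apply: HZ; rewrite ger0_norm; lra.
split.
  by rewrite sE//; apply: (le_trans (ler_normD _ _)); lra.
have [du _ _] := Hus; have [dw _ _] := Hw.
suff -> : up (x - x0) + up (x + x0) = p (x - x0) + p (x + x0).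
  by apply: (le_trans (ler_normD _ _)); lra.
have [_ <-] : is_derive x 1 (fun y => us (y - x0) + us (y + x0)) (up (x - x0) + up (x + x0)).
  by apply: is_deriveDf; exact: is_derive_shift.
have [_ <-] : is_derive x 1 (fun y => w (y - x0) + w (y + x0)) (p (x - x0) + p (x + x0)).
  by apply: is_deriveDf; exact: is_derive_shift.
apply: near_eq_derive; near=> y; apply: sE.
have : `|y - x| < 4 - `|x| by near: y; apply: near_dist; rewrite subr_gt0.
by have := ler_dist_dist y x; have := ler_norm (`|y| - `|x|); lra.
Unshelve. all: by end_near. Qed.

Lemma int_compact_support f a b M : a <= b -> continuous f ->
  (forall x, ~ (a <= x <= b) -> f x = 0) -> (forall x, `|f x| <= M) ->
  `|\int[mu]_x f x| <= M * (b - a) /\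
  (forall a' b', a' <= b' -> \int[mu]_(x in `[a', b']) `|f x| <= M * (b - a)).
Proof.
move=> ab cf f0 fM.
have lf := continuous_loc_int cf.
have f0' x : ~ `[a, b]%classic x -> f x = 0 by rewrite /= in_itv /=; exact: f0.
have l1 : loc_int (fun=> 1) by apply: continuous_loc_int; exact: cst_continuous.
have iF : mu.-integrable [set: R] (EFin \o (fun x => `|f x|)).
  have := integrable_test (@segment_compact _ a b) (@subsetT _ _) cf f0' l1.
  under [X in _ -> integrable _ _ (_ \o X)]eq_fun do rewrite -[f _]mul1r.
  by move=> /integrable_norm.
have E : \int[mu]_x `|f x| <= M * (b - a).
  rewrite (@int_support _ [set: R] `[a, b] (fun x => `|f x|)).
    by apply: int_segment_le => //; exact: loc_int_norm.
  by move=> x xx; rewrite f0' ?normr0// => H; apply: xx; split.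
split.
  rewrite (@int_support _ [set: R] `[a, b] f).
    by apply: norm_int_segment_le => //.
  by move=> x xx; rewrite f0'// => H; apply: xx; split.
by move=> a' b' _; apply: le_trans E; apply: int_segment_le_int.
Qed.

End glued_wave.

(** * The even profile *)

(** The operator [L] with the second derivative as an argument, in place of the
    weak derivative chosen in its definition. *)
Definition Lop (R : realType) (c : R) (u g : R -> R) (x : R) : R :=
  c ^+ 2 * g x - discrete_laplacian u x + alpha c * u x.

Section even_profile.
Variable R : realType.
Implicit Types (f g h u v w p q r us up ug ue lam : R -> R) (a b c x y e : R) (D : set R).
Local Notation mu := (@lebesgue_measure R).
Local Notation loc_int := (locally_integrable [set: R]).
Local Notation integrableR f := (mu.-integrable [set: R] (EFin \o f)).
Local Notation k := (k0 R).

Lemma loc_int_Lop c u p g : H2rep u p g -> loc_int (Lop c u g).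
Proof.
move=> [du [lg _] _]; have lu := continuous_loc_int (is_derive_continuous du).
have tr (z : R) : loc_int (fun x => u (x + z)) by exact: loc_int_translate.
apply: locally_integrableD; last exact: loc_intZ.
apply: locally_integrableB; first exact: loc_intZ.
apply: locally_integrableD; last exact: tr.
by apply: locally_integrableB; [exact: tr|exact: loc_intZ].
Qed.

Lemma int_Lop_le c u p g A B a b : H2rep u p g ->
  (forall a b, a <= b -> \int[mu]_(x in `[a, b]) `|g x| <= A) ->
  (forall a b, a <= b -> \int[mu]_(x in `[a, b]) `|u x| <= B) -> a <= b ->
  \int[mu]_(x in `[a, b]) `|Lop c u g x| <= c ^+ 2 * A + (4 + `|alpha c|) * B.
Proof.
move=> Hu gA uB ab; have [du [lg _] _] := Hu.
have lu := continuous_loc_int (is_derive_continuous du).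
have lgn := loc_int_norm lg; have lun := loc_int_norm lu.
have tr (z : R) : loc_int (fun x => `|u (x + z)|) by exact: (loc_int_translate z lun).
have i1 : loc_int (fun x => c ^+ 2 * `|g x| + `|u (x + 1)|).
  by apply: locally_integrableD => //; exact: loc_intZ.
have i2 : loc_int (fun x => c ^+ 2 * `|g x| + `|u (x + 1)| + `|u (x - 1)|).
  by apply: locally_integrableD => //; exact: tr.
have i3 : loc_int (fun x => (2 + `|alpha c|) * `|u x|) by exact: loc_intZ.
apply: (@le_trans _ _ (\int[mu]_(x in `[a, b])
   (c ^+ 2 * `|g x| + `|u (x + 1)| + `|u (x - 1)| + (2 + `|alpha c|) * `|u x|))).
  apply: le_int_segment.
  - by apply: loc_int_norm; exact: loc_int_Lop Hu.
  - exact: locally_integrableD.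
  - move=> x _; rewrite /Lop /discrete_laplacian.
    have -> : c ^+ 2 * g x - (u (x + 1) - 2 * u x + u (x - 1)) + alpha c * u x =
       c ^+ 2 * g x - u (x + 1) - u (x - 1) + (2 + alpha c) * u x by ring.
    apply: (le_trans (ler_normD _ _)); apply: lerD.
      apply: (le_trans (ler_normB _ _)); apply: lerD => //.
      apply: (le_trans (ler_normB _ _)); apply: lerD => //.
      by rewrite (normrM (c ^+ 2)) ger0_norm ?sqr_ge0.
    rewrite normrM; apply: ler_wpM2r => //.
    by apply: (le_trans (ler_normD _ _)); rewrite ger0_norm.
rewrite int_segmentD; [|exact: i2|exact: i3].
rewrite int_segmentD; [|exact: i1|exact: tr].
rewrite int_segmentD; [|exact: loc_intZ|exact: tr].
rewrite !int_segmentZ//.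
rewrite (@int_translate _ (fun x => `|u x|) 1)// (@int_translate _ (fun x => `|u x|) (-1))//.
have -> : c ^+ 2 * A + (4 + `|alpha c|) * B = c ^+ 2 * A + B + B + (2 + `|alpha c|) * B by ring.
apply: lerD; first apply: lerD; first apply: lerD.
- by apply: ler_wpM2l; [exact: sqr_ge0|exact: gA].
- by apply: uB; lra.
- by apply: uB; lra.
- by apply: ler_wpM2l; [rewrite addr_ge0|exact: uB].
Qed.

(** Far from the origin the oscillating part of the profile is annihilated by the
    operator, so that the integrability of the remainder is inherited by the
    image of the profile. *)
Lemma even_profile_bounds c lam ue : transition_function lam -> even_profile ue ->
  exists p g, [/\ H2rep ue p g, g = wderivn [set: R] 2 ue,
    exists2 M, 0 <= M & forall x, `|ue x| <= M /\ `|p x| <= M &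
    exists2 A, 0 <= A & forall a b, a <= b ->
      \int[mu]_(x in `[a, b]) `|Lop c ue g x| <= A].
Proof.
move=> tl [Hue eue W]; have [_ _ _ lamN lamP] := tl.
have [p Hp] := H2loc_rep Hue.
set g := wderivn _ 2 ue in Hp.
exists p, g.
have [l1 [l2 [M M0 [d0 d1 c2 l0 lM]]]] := transition_derivatives tl.
have Hh := H2repZ 2 (H2repM d0 d1 c2 (H2rep_sin_k0 R)).
set h := (fun x => 2 * _) in Hh; set h1 := (fun x => 2 * _) in Hh.
set h2 := (fun x => 2 * _) in Hh.
have Ht := H2repB Hp Hh.
set t := (fun x => _) in Ht; set t1 := (fun x => _) in Ht; set t2 := (fun x => _) in Ht.
pose D : set R := ~` `[-1, 1].
have oD : open D by apply: closed_openC; exact: interval_closed.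
pose v y := ue y - Num.sg y * sin (k * y).
have vt x : D x -> v x = t x.
  move=> Dx; rewrite /v /t /h -(transition_sg tl); first by rewrite mulrA.
  move: Dx; rewrite /D /= in_itv /= => Dx.
  by rewrite leNgt; apply/negP; rewrite ltr_norml => xx; apply: Dx; lra.
have [_ _ e1 e2] := H2rep_wderivn oD Ht vt.
have [dt Ht1 lt2] := Ht; have ct := is_derive_continuous dt.
have ct1 := abs_cont_continuous Ht1.
have [|it it_] := weighted_integrable (continuous_loc_int ct)
  (continuous_sqr_loc_int ct) (W 0 isT).
  by apply: aeW => x /vt.
have [_ it1] := weighted_integrable (continuous_loc_int ct1)
  (continuous_sqr_loc_int ct1) (W 1 isT) e1.
have [it2 it2_] := weighted_integrable Ht1.1 lt2 (W 2 isT) e2.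
have [B1 HB1] := square_integrable_bounded (C1_abs_cont dt ct1) it_ it1.
have [B2 HB2] := square_integrable_bounded Ht1 it1 it2_.
have lam1 x : `|2 * lam x| <= 1.
  by have := transition_bound x tl; rewrite ler_norml; lra.
have kpos := k0_gt0 R.
split => //.
- exists (`|B1| + `|B2| + 1 + 2 * M + k).
    by have := normr_ge0 B1; have := normr_ge0 B2; move: kpos; rewrite /k0; lra.
  move=> x; split.
  + have -> : ue x = t x + h x by rewrite /t; ring.
    apply: (le_trans (ler_normD _ _)).
    have : `|h x| <= 1 by rewrite /h mulrA normrM; apply: mulr_ile1 => //; exact: sin_max.
    have := HB1 x; have := ler_norm B1; have := normr_ge0 B2; lra.
  + have -> : p x = t1 x + h1 x by rewrite /t1; ring.
    apply: (le_trans (ler_normD _ _)).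
    have : `|h1 x| <= 2 * M + k.
      rewrite /h1 mulrDr; apply: (le_trans (ler_normD _ _)); apply: lerD.
        rewrite normrM ger0_norm//; apply: ler_wpM2l => //.
        rewrite normrM -[leRHS]mulr1; apply: ler_pM => //; last exact: sin_max.
        by case: (lM x).
      rewrite mulrA normrM -[leRHS]mul1r; apply: ler_pM => //.
      rewrite (normrM k) (gtr0_norm kpos) -[leRHS]mulr1; apply: ler_wpM2l; first exact: ltW.
      exact: cos_max.
    have := HB2 x; have := ler_norm B2; have := normr_ge0 B1; lra.
pose A0 := \int[mu]_x `|t x|; pose A2 := \int[mu]_x `|t2 x|.
have A00 : 0 <= A0 by apply: Rintegral_ge0.
have A20 : 0 <= A2 by apply: Rintegral_ge0.
have At : forall a b, a <= b ->
    \int[mu]_(x in `[a, b]) `|Lop c t t2 x| <= c ^+ 2 * A2 + (4 + `|alpha c|) * A0.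
  move=> a b ab; by apply: (@int_Lop_le c t t1 t2 A2 A0 a b Ht) => // a' b' _;
    apply: int_segment_le_int => // x.
have cLh : continuous (Lop c h h2).
  have [dh [lh2 _] _] := Hh; have ch := is_derive_continuous dh.
  have Cc (a : R) : continuous (fun _ : R => a) by exact: cst_continuous.
  have cl := is_derive_continuous d0; have cl1 := is_derive_continuous d1.
  have cs := is_derive_continuous (@is_derive_sin_k0 R).
  have cc := is_derive_continuous (@is_derive_cos_k0 R).
  have ch2 : continuous h2.
    apply: continuousMf => //.
    apply: continuousDf; [apply: continuousDf|]; do ?apply: continuousMf => //.
    by move=> x; apply: cvgN; exact: cs.
  apply: continuousDf; last exact: continuousMf.
  apply: continuousBf; first exact: continuousMf.
  apply: continuousDf; last exact: continuous_translate.
  by apply: continuousBf; [exact: continuous_translate|exact: continuousMf].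
(* For [|x| > 2] the cut-off is constant on [x - 1, x + 1]. *)
have Lh0 x : ~ (-2 <= x <= 2) -> Lop c h h2 x = 0.
  move=> xx; have x2 : 2 < `|x|.
    by rewrite ltNge ler_norml; apply/negP => H; apply: xx; lra.
  have [|z1 z2] := l0 x; first lra.
  have E y : `|y - x| <= 1 -> lam y = lam x.
    rewrite ler_norml => yx.
    have [x0|x0] := leP 0 x; rewrite ?(ger0_norm x0) ?(ltr0_norm x0) in x2.
      by rewrite !lamP//; lra.
    by rewrite !lamN//; lra.
  rewrite /Lop /discrete_laplacian /h2 /h z1 z2 (E (x + 1)); last first.
    by rewrite addrC addKr normr1.
  rewrite (E (x - 1)); last by rewrite addrAC subrr sub0r normrN1.
  rewrite !mulrDr mulrN1 mulr1 sinDpihalf sinBpihalf /alpha /k0.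
  by ring.
have [N N0 HN] := continuous_segment_bounded (-2) 2 cLh.
have LhN x : `|Lop c h h2 x| <= N.
  case: (pselect (-2 <= x <= 2)) => xx; first exact: HN.
  by rewrite Lh0// normr0 ltW.
have [_ Ah] := int_compact_support (ltac:(lra) : -2 <= 2 :> R) cLh Lh0 LhN.
exists (c ^+ 2 * A2 + (4 + `|alpha c|) * A0 + N * (2 - -2)).
  apply: addr_ge0; last by apply: mulr_ge0; [exact: ltW|lra].
  by apply: addr_ge0; apply: mulr_ge0 => //; rewrite ?sqr_ge0 ?addr_ge0.
move=> a b ab.
have lt := loc_int_norm (loc_int_Lop c Ht); have lh := loc_int_norm (loc_int_Lop c Hh).
apply: (@le_trans _ _ (\int[mu]_(x in `[a, b]) (`|Lop c t t2 x| + `|Lop c h h2 x|))).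
  apply: le_int_segment.
  - by apply: loc_int_norm; exact: loc_int_Lop Hp.
  - exact: locally_integrableD.
  - move=> x _; have -> : Lop c ue g x = Lop c t t2 x + Lop c h h2 x.
      by rewrite /Lop /discrete_laplacian /t /t2; ring.
    exact: ler_normD.
by rewrite int_segmentD//; apply: lerD; [exact: At|exact: Ah].
Qed.

End even_profile.

(** * The perturbation of the glued wave *)

Section perturbation.
Variable R : realType.
Implicit Types (f g h u v w p q r us up ug ue lam : R -> R) (a b c x y e : R) (D : set R).
Local Notation mu := (@lebesgue_measure R).
Local Notation loc_int := (locally_integrable [set: R]).
Local Notation integrableR f := (mu.-integrable [set: R] (EFin \o f)).
Local Notation k := (k0 R).

Lemma H2_H2loc u : H2 u -> H2loc u.
Proof.
move=> [cu W L2u]; split => // l l2 K cK; have [mf H] := L2u l l2.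
have mK := compact_measurable cK.
split; first exact: measurable_funTS.
apply: le_lt_trans H; apply: ge0_subset_integral => //.
- by apply/measurable_EFinP; exact: measurable_funX.
- by move=> x _; rewrite lee_fin sqr_ge0.
Qed.

Lemma integrable_sqr_ae f g : L2 [set: R] f -> measurable_fun [set: R] g ->
  {ae mu, forall x, f x = g x} -> integrableR (fun x => g x ^+ 2).
Proof.
move=> [mf Hf] mg fg; apply/integrableP; split.
  by apply/measurable_EFinP; exact: measurable_funX.
apply: le_lt_trans Hf; rewrite le_eqVlt; apply/orP; left; apply/eqP.
apply: ae_eq_integral => //.
- by apply: measurableT_comp => //; apply/measurable_EFinP; exact: measurable_funX.
- by apply/measurable_EFinP; exact: measurable_funX.
- by apply: ae_imply fg => x -> _; rewrite gee0_abs// lee_fin sqr_ge0.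
Qed.

Lemma H2_rep_decay r : H2 r -> exists p, [/\ H2rep r p (wderivn [set: R] 2 r),
  exists M, forall x, `|r x| <= M &
  forall e, 0 < e -> exists X, forall x, X <= x -> `|r x| <= e /\ `|p x| <= e].
Proof.
move=> Hr; have [cr W L2r] := Hr.
have [p Hp] := H2loc_rep (H2_H2loc Hr).
have [dr Hpg lg2] := Hp; have cp := abs_cont_continuous Hpg.
have [_ _ e1 _] := H2rep_wderivn openT Hp (fun x _ => erefl (r x)).
have i0 : integrableR (fun x => r x ^+ 2).
  by apply: (integrable_sqr_ae (L2r 0 isT)); [exact: continuous_measurable_fun|exact: aeW].
have i1 : integrableR (fun x => p x ^+ 2).
  apply: (integrable_sqr_ae (L2r 1 isT)); first exact: continuous_measurable_fun.
  by apply: ae_imply e1 => x; apply.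
have i2 : integrableR (fun x => wderivn [set: R] 2 r x ^+ 2).
  apply: (integrable_sqr_ae (L2r 2 isT)); first by case: (L2r 2 isT).
  exact: aeW.
exists p; split => //.
  exact: (square_integrable_bounded (C1_abs_cont dr cp) i0 i1).
move=> e e0.
have [X1 H1] := square_integrable_decay (C1_abs_cont dr cp) i0 i1 e0.
have [X2 H2] := square_integrable_decay Hpg i1 i2 e0.
exists (Num.max X1 X2) => x; rewrite ge_max => /andP[x1 x2].
by split; [exact: H1|exact: H2].
Qed.

Lemma measurable_sg f : measurable_fun [set: R] f ->
  measurable_fun [set: R] (fun x => Num.sg (f x)).
Proof.
move=> mf; apply: (@measurableT_comp _ _ _ _ _ _ (fun y : R => Num.sg y)) => //.
apply: nondecreasing_measurable => // x y xy.
case: (ltgtP y 0) => y0; case: (ltgtP x 0) => x0;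
  first [rewrite (ltr0_sg y0) | rewrite (gtr0_sg y0) | rewrite y0 sgr0];
  first [rewrite (ltr0_sg x0) | rewrite (gtr0_sg x0) | rewrite x0 sgr0]; lra.
Qed.

(** The integral of the defect controls the coefficient of the profile, hence
    the source of the equation for the correction [r], hence [r] through
    [apriori_bound]. The defect lives in a fixed segment and tends to zero as [x0]
    grows. *)
Lemma perturbation_small c us lam ue : 83 / 100 <= c ^+ 2 ->
  single_transition c us -> transition_function lam -> even_profile ue ->
  forall e, 0 < e -> exists2 X, 0 < X & forall x0 r,
    (exists m : int, x0 = 2 * m%:~R) -> X <= x0 ->
    is_correction c lam us ue x0 r ->
    exists p, forall x,
      let w y := beta_e c lam us x0 * ue y +
                 gamma_tilde c lam us ue r x0 * cos (k * y) - r y in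
      [/\ is_derive x 1 w (p x), `|w x| <= e & `|p x| <= e].
Proof.
move=> c2 ST tl EP e e0.
have [l1 [l2 [M M0 [d0 d1 cl2 l0 lM]]]] := transition_derivatives tl.
have [[_ [Hus _] _] _] := ST.
have [up Hup] := H2loc_rep Hus.
have [ep [eg [Hue egE [U U0 HU] [A A0 HA]]]] := even_profile_bounds c tl EP.
have [C C0 HC] := apriori_bound c2.
(* In terms of the size [s0] of the mismatch of the two waves: [K] bounds the
   defect, [Kb] the coefficient beta, [KF] the source of the equation for the
   correction, and [KT] the whole perturbation. *)
pose K := c ^+ 2 * (3 * M) + 2.
have K0 : 0 <= K.
  by rewrite /K; apply: addr_ge0 => //; apply: mulr_ge0; [exact: sqr_ge0|exact: mulr_ge0].
pose Kb := `|(2 * (c ^+ 2 * k - 1))^-1| * (K * 4).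
have Kb0 : 0 <= Kb by rewrite mulr_ge0// mulr_ge0.
pose KF := Kb * A + K * 4.
have KF0 : 0 <= KF by rewrite addr_ge0 ?mulr_ge0.
have kpos := k0_gt0 R.
pose KT := (1 + k) * (Kb * U + C * KF) + (Kb * U + C * KF).
have KU0 : 0 <= Kb * U + C * KF by rewrite addr_ge0// mulr_ge0// ltW.
have KT0 : 0 <= KT by rewrite addr_ge0// mulr_ge0// addr_ge0// ltW.
pose s0 := e / (KT + 1).
have s00 : 0 < s0 by rewrite divr_gt0// ltr_wpDl.
have [Z Z0 HZ] := translates_cancel ST tl Hup s00.
exists (Z + 2); first lra.
move=> x0 r ev x0Z [Hr er Lr].
have small := HZ x0 ev ltac:(lra).
have [sx0 cx0] := even_integer_phase ev.
pose s x := us (x - x0) + us (x + x0).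
pose s1 x := up (x - x0) + up (x + x0).
pose G := gluing_defect c lam l1 l2 s s1.
have Gb x := gluing_defect_bound c x tl l0 lM small.
have x01 : 1 < x0 by lra.
have Gd := vp_defect ST tl d0 d1 cl2 Hup erefl x01.
rewrite -/s -/s1 -/G in Gd.
have [dus Hpus _] := Hup.
have cus := is_derive_continuous dus; have cup := abs_cont_continuous Hpus.
have cG : continuous G.
  apply: gluing_defect_continuous => //.
  - exact: is_derive_continuous d0.
  - exact: is_derive_continuous d1.
  - by apply: continuousDf; exact: continuous_translate.
  - by apply: continuousDf; exact: continuous_translate.
have G0 x : ~ (-2 <= x <= 2) -> G x = 0.
  move=> xx; apply: (Gb x).2; rewrite ltW// ltNge ler_norml.
  by apply/negP => H; apply: xx; lra.
have GK x : `|G x| <= K * s0 by exact: (Gb x).1.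
have b22 : -2 <= 2 :> R by lra.
have [_ GI] := int_compact_support b22 cG G0 GK.
have lG := continuous_loc_int cG.
have ccos := is_derive_continuous (@is_derive_cos_k0 R).
pose be := beta_e c lam us x0.
have Hb : `|be| <= Kb * s0.
  rewrite /be /beta_e.
  have -> : \int[mu]_x ((- L c (vp lam us x0) x + alpha c * Num.sg (vp lam us x0 x)) * cos (k * x))
     = \int[mu]_x (G x * cos (k * x)).
    have [q Hq] := vp_H2rep x0 d0 d1 cl2 Hup.
    have [[cvp _ _] ae2] := H2rep_H2loc Hq.
    have [W1 W2 _ _] := H2rep_wderivn openT Hq (fun x _ => erefl _).
    have [_ [m2 _ _] _] := wderivP W2.
    have mc : measurable_fun [set: R] (fun x => cos (k * x)) by exact: continuous_measurable_fun.
    rewrite /Rintegral; congr fine; apply: ae_eq_integral => //.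
    - apply/measurable_EFinP; apply: measurable_funM => //.
      apply: measurable_funD; last first.
        by apply: measurable_funM => //; apply: measurable_sg; exact: continuous_measurable_fun.
      apply: measurableT_comp => //; rewrite /L.
      apply: measurable_funD; last first.
        by apply: measurable_funM => //; exact: continuous_measurable_fun.
      apply: measurable_funB; first exact: measurable_funM.
      apply: continuous_measurable_fun.
      apply: continuousDf; last exact: continuous_translate.
      apply: continuousBf; first exact: continuous_translate.
      by apply: continuousMf => //; exact: cst_continuous.
    - apply/measurable_EFinP; apply: measurable_funM => //; exact: continuous_measurable_fun.
    - by apply: ae_imply Gd => x -> _.
  rewrite normrM /Kb -mulrA; apply: ler_wpM2l => //.
  have cGc : continuous (fun x => G x * cos (k * x)).
    by move=> x; apply: cvgM; [exact: cG|exact: ccos].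
  have Gc0 x : ~ (-2 <= x <= 2) -> G x * cos (k * x) = 0 by move=> /G0 ->; rewrite mul0r.
  have GcK x : `|G x * cos (k * x)| <= K * s0.
    by rewrite normrM; apply: le_trans (GK x); rewrite ler_piMr// cos_max.
  have [H _] := int_compact_support b22 cGc Gc0 GcK.
  by apply: (le_trans H); rewrite le_eqVlt; apply/orP; left; apply/eqP; ring.
have [p [Hp rM rdec]] := H2_rep_decay Hr.
pose f x := be * Lop c ue eg x - G x.
have lL := loc_int_Lop c Hue.
have lf : loc_int f by apply: locally_integrableB => //; exact: loc_intZ.
have Hf : {ae mu, forall x, c ^+ 2 * wderivn [set: R] 2 r x - discrete_laplacian r x
     + alpha c * r x = f x}.
  apply: ae_imply2 Lr Gd => x; rewrite /f /Lop egE -/(L c ue x) -/(L c r x) => -> <-.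
  by rewrite -/be; ring.
have fF a b : a <= b -> \int[mu]_(x in `[a, b]) `|f x| <= KF * s0.
  move=> ab; apply: (@le_trans _ _ (\int[mu]_(x in `[a, b]) (`|be| * `|Lop c ue eg x| + `|G x|))).
    apply: le_int_segment.
    - exact: loc_int_norm.
    - apply: locally_integrableD; last exact: loc_int_norm.
      by apply: loc_intZ; exact: loc_int_norm.
    - by move=> x _; rewrite /f -normrM; exact: ler_normB.
  rewrite int_segmentD; [|by apply: loc_intZ; exact: loc_int_norm|exact: loc_int_norm].
  rewrite int_segmentZ; last exact: loc_int_norm.
  have -> : KF * s0 = (Kb * s0) * A + (K * s0) * (2 - -2) by rewrite /KF; ring.
  apply: lerD; last exact: GI.
  by apply: ler_pM => //; [apply: int_segment_ge0|exact: HA].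
have rp := HC _ _ _ _ _ Hp lf Hf rM rdec fF.
pose ga := gamma_tilde c lam us ue r x0.
have Hbu x : `|be * ue x| <= (Kb * U) * s0.
  rewrite normrM (_ : Kb * U * s0 = Kb * s0 * U); last by ring.
  by apply: ler_pM => //; case: (HU x).
have Hg : `|ga| <= (Kb * U + C * KF) * s0.
  rewrite /ga /gamma_tilde normrM normfV cx0 invr1 mulr1 mulrDl [leRHS]addrC.
  apply: (le_trans (ler_normB _ _)); apply: lerD; last exact: Hbu.
  by rewrite -mulrA; case: (rp x0).
have [due _ _] := Hue; have [dr _ _] := Hp.
exists (fun x => be * ep x + ga * (k * - sin (k * x)) - p x) => x w.
have KTe : KT * s0 <= e.
  by rewrite /s0 mulrA ler_pdivrMr ?ltr_wpDl// mulrC; nra.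
have sb y : `|be * ep y| <= Kb * U * s0.
  rewrite normrM (_ : Kb * U * s0 = Kb * s0 * U); last by ring.
  by apply: ler_pM => //; case: (HU y).
have [rx px] := rp x.
split.
- exact: (is_deriveBf (is_deriveDf (is_deriveZf be (due x))
    (is_deriveZf ga (is_derive_cos_k0 x))) (dr x)).
- apply: le_trans KTe; rewrite /w /=; apply: (le_trans (ler_normB _ _)).
  have H1 := le_trans (ler_normD (be * ue x) (ga * cos (k * x)))
    (lerD (Hbu x) (lexx `|ga * cos (k * x)|)).
  have H2 : `|ga * cos (k * x)| <= (Kb * U + C * KF) * s0.
    by rewrite normrM; apply: le_trans Hg; rewrite ler_piMr// cos_max.
  have H3 : 0 <= k * (Kb * U + C * KF) * s0.
    by apply: mulr_ge0; [apply: mulr_ge0 => //; exact: ltW|exact: ltW].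
  rewrite -/be -/ga /KT; apply: (le_trans (lerD H1 (lexx _))).
  by move: H2 H3 rx; clear; lra.
- apply: le_trans KTe; apply: (le_trans (ler_normB _ _)).
  have H1 := le_trans (ler_normD (be * ep x) (ga * (k * - sin (k * x))))
    (lerD (sb x) (lexx `|ga * (k * - sin (k * x))|)).
  have H2 : `|ga * (k * - sin (k * x))| <= (Kb * U + C * KF) * s0 * k.
    rewrite normrM; apply: ler_pM => //.
    by rewrite (normrM k) normrN (gtr0_norm kpos) ler_piMr ?(ltW kpos)// sin_max.
  have H3 : 0 <= (Kb * U + C * KF) * s0 by apply: mulr_ge0 => //; exact: ltW.
  rewrite /KT; apply: (le_trans (lerD H1 (lexx _))).
  by move: H2 H3 px; clear; lra.
Qed.

End perturbation.

(** * The sign pattern *)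

Section sign.
Variable R : realType.
Implicit Types (f g h u v w p q r us up ug ue lam : R -> R) (a b c x y e : R) (D : set R).
Local Notation mu := (@lebesgue_measure R).
Local Notation k := (k0 R).

(** A [C^1]-small even perturbation that vanishes at [x0] does not move the
    transition: near [x0] the sum is increasing, elsewhere the wave dominates. *)
Lemma glued_wave_sign c us lam up ug : single_transition c us ->
  transition_function lam -> H2rep us up ug ->
  exists2 e, 0 < e & exists X, forall x0 w p, X <= x0 ->
    even_fun w -> w x0 = 0 -> (forall x, is_derive x 1 w (p x)) ->
    (forall x, `|w x| <= e /\ `|p x| <= e) ->
    [/\ vp lam us x0 x0 + w x0 = 0,
        forall x, - x0 < x < x0 -> vp lam us x0 x + w x < 0 &
        forall x, ~ (- x0 <= x <= x0) -> 0 < vp lam us x0 x + w x].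
Proof.
move=> ST tl Hus; have [[ous [_ sol] sus] [dpos _ _]] := ST.
have [dus Hpus _] := Hus; have cup := abs_cont_continuous Hpus.
have up0 : 0 < up 0.
  by have [_ <-] := dus 0; rewrite -derive1E.
have [d d0 Hd] : exists2 d, 0 < d & forall y, `|y| <= d -> up 0 / 2 < up y.
  have : \forall y \near (0 : R), up 0 / 2 < up y.
    by have /(cvgr_gt (up 0)) := cup 0; apply; lra.
  move=> /nbhs_ballP[d /= d0 Hd]; exists (d / 2); first by rewrite divr_gt0.
  by move=> y yd; apply: Hd; rewrite /ball /= sub0r normrN; lra.
have [m m0 Hm] := single_transition_away ST d0.
have us0 : us 0 = 0 by apply/eqP; rewrite -sgr_eq0 sus sgr0.
have usP y : d <= y -> m <= us y.
  move=> dy; have y0 : 0 < y by exact: lt_le_trans dy.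
  have := Hm y; rewrite (gtr0_norm y0) => /(_ dy).
  by rewrite gtr0_norm// -sgr_cp0 sus gtr0_sg.
have usN y : y <= - d -> us y <= - m.
  by move=> yd; have := usP (- y); rewrite ous; lra.
exists (Num.min (m / 2) (up 0 / 4)); first by rewrite lt_min !divr_gt0.
exists (d + 1) => x0 w p Xx0 ew w0 dw small.
have wm x : `|w x| <= m / 2.
  by have [h _] := small x; apply: (le_trans h); rewrite ge_min lexx.
have pm x : `|p x| <= up 0 / 4.
  by have [_ h] := small x; apply: (le_trans h); rewrite ge_min lexx orbT.
have dF x : is_derive x 1 (fun y => us (y - x0) + w y) (up (x - x0) + p x).
  by apply: is_deriveDf; exact: is_derive_shift.
have near_mono x y : x < y -> `|x - x0| <= d -> `|y - x0| <= d ->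
    us (x - x0) + w x < us (y - x0) + w y.
  move=> xy; rewrite !ler_norml => xd yd.
  have [z] := MVT xy (fun x _ => dF x)
    (continuous_subspaceT (is_derive_continuous dF)).
  rewrite in_itv /= => /andP[xz zy] E.
  have : `|z - x0| <= d by rewrite ler_norml; lra.
  move=> /Hd Hz; have := pm z; rewrite ler_norml => pz.
  rewrite -subr_gt0 E; apply: mulr_gt0; lra.
have E0 : us (x0 - x0) + w x0 = 0 by rewrite subrr us0 w0 addr0.
have x01 : 1 <= x0 by lra.
have neg x : 0 <= x -> x < x0 -> vp lam us x0 x + w x < 0.
  move=> x0' xx0; have [xd|xd] := leP (x0 - d) x.
    rewrite (vp_right _ _ tl); last lra.
    have H1 : `|x - x0| <= d by rewrite ler_norml; lra.
    have H2 : `|x0 - x0| <= d by rewrite subrr normr0 ltW.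
    by have := near_mono x x0 xx0 H1 H2; rewrite E0.
  have H1 : us (x - x0) <= - m by apply: usN; lra.
  have H2 : m <= us (x + x0) by apply: usP; lra.
  have := vp_middle tl H1 H2; have := wm x; rewrite ler_norml; lra.
have pos x : x0 < x -> 0 < vp lam us x0 x + w x.
  move=> xx0; rewrite (vp_right _ _ tl); last lra.
  have [xd|xd] := leP x (x0 + d).
    have H1 : `|x - x0| <= d by rewrite ler_norml; lra.
    have H2 : `|x0 - x0| <= d by rewrite subrr normr0 ltW.
    by have := near_mono x0 x xx0 H2 H1; rewrite E0.
  have H1 : m <= us (x - x0) by apply: usP; lra.
  have := wm x; rewrite ler_norml; lra.
have ol : odd_fun lam by case: tl.
have ev x : vp lam us x0 (- x) + w (- x) = vp lam us x0 x + w x.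
  by rewrite (vp_even x0 ol ous) ew.
split.
- by rewrite (vp_right _ _ tl).
- move=> x xx; have [x0'|x0'] := leP 0 x; first by apply: neg; lra.
  by rewrite -ev; apply: neg; lra.
- move=> x xx; have [x0'|x0'] := leP 0 x.
    by apply: pos; rewrite ltNge; apply/negP => H; apply: xx; lra.
  rewrite -ev; apply: pos; rewrite ltNge; apply/negP => H; apply: xx; lra.
Qed.

Lemma sg_determined u v x0 : even_fun u -> even_fun v -> u x0 = 0 -> v x0 = 0 ->
  (forall x, - x0 < x < x0 -> u x < 0) -> (forall x, - x0 < x < x0 -> v x < 0) ->
  (forall x, ~ (- x0 <= x <= x0) -> 0 < u x) ->
  (forall x, ~ (- x0 <= x <= x0) -> 0 < v x) ->
  forall x, Num.sg (u x) = Num.sg (v x).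
Proof.
move=> eu ev u0 v0 uneg vneg upos vpos x.
have [xx|xx] := pselect (- x0 < x < x0).
  by rewrite !ltr0_sg ?uneg ?vneg.
have [xy|xy] := pselect (- x0 <= x <= x0); last by rewrite !gtr0_sg ?upos ?vpos.
have [xp|xn] := leP 0 x.
  have -> : x = x0.
    apply/eqP; rewrite eq_le; apply/andP; split; first lra.
    by rewrite leNgt; apply/negP => H; apply: xx; lra.
  by rewrite u0 v0.
have -> : x = - x0.
  apply/eqP; rewrite eq_le; apply/andP; split; last lra.
  by rewrite leNgt; apply/negP => H; apply: xx; lra.
by rewrite eu ev u0 v0.
Qed.

(** The two unit shifts of the cosine cancel because [k0] is pi/2. *)
Lemma Lop_cos_k0 c x : Lop c (fun y => cos (k * y)) (fun y => k * - (k * cos (k * y))) x = 0.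
Proof.
rewrite /Lop /discrete_laplacian mulrDr mulrBr mulr1 cosDpihalf cosBpihalf.
by rewrite /alpha /k0; ring.
Qed.

Lemma Lop_combination c be ga u1 g1 u2 g2 u3 g3 u4 g4 x :
  Lop c (fun y => u1 y + be * u2 y + ga * u3 y - u4 y)
        (fun y => g1 y + be * g2 y + ga * g3 y - g4 y) x =
  Lop c u1 g1 x + be * Lop c u2 g2 x + ga * Lop c u3 g3 x - Lop c u4 g4 x.
Proof. by rewrite /Lop /discrete_laplacian; ring. Qed.

Lemma perturbation_even c us lam ue r x0 : even_fun ue -> even_fun r ->
  even_fun (fun x => beta_e c lam us x0 * ue x +
    gamma_tilde c lam us ue r x0 * cos (k * x) - r x).
Proof. by move=> eu er x; rewrite eu er mulrN cosN. Qed.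

End sign.

Theorem theorem4p3 (R : realType) (c : R) (us lambda ue : R -> R)
    (hc : 0 < c) (hc2 : 83 / 100 <= c ^+ 2 <= 1)
    (hus : single_transition c us)
    (hlambda : transition_function lambda)
    (hue : even_profile ue) :
  exists2 X : R, 0 < X &
    forall (x0 : R) (r : R -> R),
      (exists m : int, x0 = 2 * m%:~R) -> X <= x0 ->
      is_correction c lambda us ue x0 r ->
      let u := two_transition_ansatz c lambda us ue r x0 in
      [/\ even_fun u, is_solution c u &
          [/\ u (- x0) = 0, u x0 = 0,
              forall x, - x0 < x < x0 -> u x < 0 &
              forall x, ~ (- x0 <= x <= x0) -> 0 < u x]].
Proof.
have /andP[c2 _] := hc2.
have [[ous [Hus _] sus] _] := hus.
have [up Hup] := H2loc_rep Hus.
have [Hueloc eue _] := hue.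
have [up_e Hue] := H2loc_rep Hueloc.
have [e e0 [X0 HX0]] := glued_wave_sign hus hlambda Hup.
have [X X_gt0 HX] := perturbation_small c2 hus hlambda hue e0.
exists (Num.max (Num.max X0 X) 2); first by rewrite lt_max ltr0n orbT.
move=> x0 r ev; rewrite !ge_max => /andP[/andP[x0X0 x0X] x02] Hr u.
have [p Hp] := HX x0 r ev x0X Hr.
have [Hr2 er Lr] := Hr.
have [_ cx0] := even_integer_phase ev.
have cx0' : cos (k0 R * x0) != 0 by rewrite -normr_gt0 cx0.
pose w y := beta_e c lambda us x0 * ue y +
  gamma_tilde c lambda us ue r x0 * cos (k0 R * y) - r y.
have uE (x : R) : u x = vp lambda us x0 x + w x.
  by rewrite /u /two_transition_ansatz /w; ring.
have ew : even_fun w by exact: perturbation_even.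
have w0 : w x0 = 0.
  by rewrite /w /gamma_tilde mulfVK//; ring.
have dw (x : R) : is_derive x 1 w (p x) by case: (Hp x).
have sw (x : R) : `|w x| <= e /\ `|p x| <= e by case: (Hp x).
have [u0 uneg upos] := HX0 x0 w p x0X0 ew w0 dw sw.
have ol : odd_fun lambda by case: hlambda.
have eu : even_fun u.
  by move=> x; rewrite !uE (vp_even x0 ol ous) ew.
(* With the zero perturbation, this is the sign pattern of the glued wave. *)
have z0 (x : R) : is_derive x 1 (fun _ : R => 0 : R) 0 by exact: is_derive_cst.
have ze (x : R) : `|0 : R| <= e /\ `|0 : R| <= e by rewrite normr0 ltW.
have [v0 vneg vpos] := HX0 x0 (fun=> 0) (fun=> 0) x0X0 (fun=> erefl) erefl z0 ze.
have v0' : vp lambda us x0 x0 = 0 by rewrite -[LHS]addr0.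
have u0' : u x0 = 0 by rewrite uE.
have vneg' (x : R) : - x0 < x < x0 -> vp lambda us x0 x < 0.
  by move=> /vneg; rewrite addr0.
have vpos' (x : R) : ~ (- x0 <= x <= x0) -> 0 < vp lambda us x0 x.
  by move=> /vpos; rewrite addr0.
have uneg' (x : R) : - x0 < x < x0 -> u x < 0 by rewrite uE; exact: uneg.
have upos' (x : R) : ~ (- x0 <= x <= x0) -> 0 < u x by rewrite uE; exact: upos.
have sgE := sg_determined eu (vp_even x0 ol ous) u0' v0' uneg' vneg' upos' vpos'.
split => //; last by split => //; rewrite eu.
have [l1 [l2 [M M0 [d0 d1 cl2 _ _]]]] := transition_derivatives hlambda.
have [q Hv] := vp_H2rep x0 d0 d1 cl2 Hup.
set vg := (fun x => _) in Hv.
have [rp [Hrp _ _]] := H2_rep_decay Hr2.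
have Hu := H2repB (H2repD (H2repD Hv (H2repZ (beta_e c lambda us x0) Hue))
  (H2repZ (gamma_tilde c lambda us ue r x0) (H2rep_cos_k0 R))) Hrp.
have [Hu2 ae_u] := H2rep_H2loc Hu.
have [_ ae_v] := H2rep_H2loc Hv.
split; first exact: Hu2.
move: ae_u ae_v Lr; apply: ae_imply3 => x Eu Ev Er.
have -> : L c u x = Lop c (vp lambda us x0) vg x
    + beta_e c lambda us x0 * Lop c ue (wderivn [set: R] 2 ue) x
    + gamma_tilde c lambda us ue r x0 *
      Lop c (fun y => cos (k0 R * y)) (fun y => k0 R * - (k0 R * cos (k0 R * y))) x
    - Lop c r (wderivn [set: R] 2 r) x.
  by rewrite -Lop_combination /L Eu.
have -> : Lop c (vp lambda us x0) vg x = L c (vp lambda us x0) x by rewrite /L Ev.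
rewrite sgE Lop_cos_k0 -[Lop c r _ x]/(L c r x) -[Lop c ue _ x]/(L c ue x) Er.
ring.
Qed.
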